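(* Let $p,q:\mathbb{R}^2\to\mathbb{R}$ be two finite linear-like submersions. Then $p$ and $q$ are topologically equivalent if and only if either $B(p)=B(q)=\emptyset$, or both of the following conditions hold: (a) $\mathscr{F}(p)$ and $\mathscr{F}(q)$ are topologically equivalent. (b) There exist an equivalence homeomorphism $h:\mathbb{R}^2\to\mathbb{R}^2$ between $\mathscr{F}(p)$ and $\mathscr{F}(q)$ and a monotone bijection $\sigma:B(p)\to B(q)$ such that $p^{-1}(\sigma^{-1}(c))=h^{-1}(q^{-1}(c))$ for each $c\in B(q)$.
   Context: A linear-like function is a function $p:\mathbb{R}^2\to\mathbb{R}$ of the form $p(x,y)=r(x)+s(x)y$, where $r,s:\mathbb{R}\to\mathbb{R}$ are $C^\infty$. It is a submersion if its gradient vanishes nowhere. A finite linear-like submersion is a linear-like submersion for which $\{x\in\mathbb{R}: s(x)=0\}$ is finite (possibly empty). For a $C^\infty$ submersion $f:\mathbb{R}^2\to\mathbb{R}$, $\mathscr{F}(f)$ denotes the regular foliation of $\mathbb{R}^2$ whose leaves are the connected components of the level sets of $f$. Two functions $f,g:\mathbb{R}^2\to\mathbb{R}$ are topologically equivalent if there exist homeomorphisms $h:\mathbb{R}^2\to\mathbb{R}^2$ and $\ell:\mathbb{R}\to\mathbb{R}$ such that $\ell\circ f=g\circ h$. Two regular foliations $\mathscr{F},\mathscr{G}$ of $\mathbb{R}^2$ are topologically equivalent if there is a homeomorphism $h:\mathbb{R}^2\to\mathbb{R}^2$ carrying each leaf of $\mathscr{F}$ onto a leaf of $\mathscr{G}$;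 such $h$ is called an equivalence homeomorphism between $\mathscr{F}$ and $\mathscr{G}$. Bifurcation set: a continuous map $p:X\to Y$ between topological spaces is a trivial fibration if there are a topological space $F$ and a homeomorphism $\varphi:F\times Y\to X$ such that $p\circ\varphi$ is the projection onto $Y$. It is a locally trivial fibration at $y\in Y$ if there is a neighbourhood $U$ of $y$ such that the restriction $p:p^{-1}(U)\to U$ is a trivial fibration. $B(p)$ is the set of $y\in Y$ at which $p$ is not a locally trivial fibration. Monotone means (strictly) increasing or (strictly) decreasing. *)

(* Defs.v *)
From HB Require Import structures.
From mathcomp Require Import all_boot all_order all_algebra.
From mathcomp Require Import all_classical all_reals all_analysis.
From mathcomp Require Import subtype_topology.
Import Order.TTheory GRing.Theory Num.Theory numFieldNormedType.Exports.

Set Implicit Arguments.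
Unset Strict Implicit.
Unset Printing Implicit Defensive.

Local Open Scope classical_set_scope.
Local Open Scope ring_scope.

Definition homeomorphism (X Y : topologicalType) (f : X -> Y) : Prop :=
  exists g : Y -> X, [/\ cancel f g, cancel g f, continuous f & continuous g].

Definition smooth (R : realType) (f : R -> R) : Prop :=
  forall (n : nat) (x : R), derivable (f^`(n))%classic x 1.

Definition linear_like_of (R : realType) (r s : R -> R) (p : R * R -> R) : Prop :=
  [/\ smooth r, smooth s & forall x y : R, p (x, y) = r x + s x * y].

Definition gradient (R : realType) (f : R * R -> R) (z : R * R) : R * R :=
  ('D_(1, 0) f z, 'D_(0, 1) f z).

(* ['D_v f z] is a junk value when the directional derivative does not exist,
   so this is meaningful only for differentiable [f], as linear-like functions
   are. *)
Definition submersion (R : realType) (f : R * R -> R) : Prop :=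
  forall z : R * R, gradient f z != 0.

(* [s] is determined by [p], since s x = p (x, 1) - p (x, 0). *)
Definition finite_linear_like_submersion (R : realType) (p : R * R -> R) : Prop :=
  exists r s : R -> R,
    [/\ linear_like_of r s p, submersion p & finite_set [set x | s x = 0]].

(* A foliation is represented by its set of leaves. *)
Definition foliation (R : realType) (f : R * R -> R) : set (set (R * R)) :=
  [set L | exists z : R * R, L = connected_component (f @^-1` [set f z]) z].

Definition equivalence_homeomorphism (R : realType) (F G : set (set (R * R)))
    (h : R * R -> R * R) : Prop :=
  homeomorphism h /\ forall L, F L -> G (h @` L).

Definition foliations_equivalent (R : realType) (F G : set (set (R * R))) : Prop :=
  exists h : R * R -> R * R, equivalence_homeomorphism F G h.

Definition topologically_equivalent (R : realType) (f g : R * R -> R) : Prop :=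
  exists (h : R * R -> R * R) (l : R -> R),
    [/\ homeomorphism h, homeomorphism l & l \o f = g \o h].

Definition trivial_fibration (X Y : topologicalType) (p : X -> Y) : Prop :=
  continuous p /\
  exists (F : topologicalType) (phi : F * Y -> X),
    homeomorphism phi /\ p \o phi = snd.

(* A set coerces to the corresponding subtype, with the subspace topology. *)
Definition restr_preimage (X Y : topologicalType) (p : X -> Y) (U : set Y)
    (x : p @^-1` U) : U :=
  SigSub (mem_set (set_mem (valP x) : U (p (val x)))).

Definition locally_trivial_at (X Y : topologicalType) (p : X -> Y) (y : Y) : Prop :=
  exists U : set Y, nbhs y U /\ trivial_fibration (@restr_preimage X Y p U).

Definition bifurcation_set (X Y : topologicalType) (p : X -> Y) : set Y :=
  [set y | ~ locally_trivial_at p y].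

Definition monotone_on (R : realType) (A : set R) (f : R -> R) : Prop :=
  (forall x y, A x -> A y -> x < y -> f x < f y) \/
  (forall x y, A x -> A y -> x < y -> f y < f x).

(* Main.v *)
(* Let p (x, y) = r x + s x * y.  Over a strip between consecutive zeros of s
   every level of p is a graph, and the line over a zero a is a leaf, isolated in
   the level r a, which makes r a a bifurcation value.

   A homeomorphism h that maps leaves of p to leaves of q and respects the
   bifurcation levels induces, over each strip i, a map g_i of the values of p to
   the values of q.  It is continuous and locally injective, hence monotone; it is
   onto because the image leaves finally stay in one strip of q; and all g_i have
   the same direction, as one sees along a horizontal segment across a vertical
   leaf.  With l = g_0, the maps U_i = g_i^-1 o l are increasing and fix the values
   on the vertical leaves, and (h o K, l) is the required equivalence for any
   homeomorphism K of the plane that preserves the strips, is the identity on the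
   vertical leaves, and satisfies p o K = U_i o p over the strip i.

   Over a strip a point is determined by its abscissa and its level, so that K has
   to move the abscissa in a way that depends on the two levels and becomes
   invisible close to the vertical leaves; the explicit formula uses that
   s = o(r - r a) near a zero a of s, with a Lipschitz version of this estimate. *)
Require Import Defs.
From HB Require Import structures.
From mathcomp Require Import all_boot all_order all_algebra.
From mathcomp Require Import all_classical all_reals all_analysis.
From mathcomp Require Import subtype_topology.
From mathcomp Require Import ring lra.
Import Order.TTheory GRing.Theory Num.Theory numFieldNormedType.Exports.

Set Implicit Arguments.
Unset Strict Implicit.
Unset Printing Implicit Defensive.

Local Open Scope classical_set_scope.
Local Open Scope ring_scope.

(** Keeping the abscissa and only replacing the level [c] by [U c] would shift the ordinate by
    [(U c - c) / s x], which need not stay bounded near a zero [a] of [s]. On one side of [a], take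
    [t = |r x - r a|] as coordinate, [S t] for [|s x|] and [C] for the signed level, so that
    [y = (C - t) / S t] up to sign. If [y] stays bounded while [t] tends to 0, then [C / t] tends to
    1, and the Lipschitz estimate makes [S C / S t] tend to 1, which [S t = o(t)] alone would not.
    Hence [y] is asymptotic to [(C - t) / S C], a quantity attached to each level separately.
    Sliding from one level to another at constant value of a parameter that is a function of this
    quantity near the leaf preserves the limiting ordinate. Only levels with [C > 0] approach the
    leaf from this side, so the parameter must also survive the passage [C -> 0] at fixed [t > 0].
    Condition (b) enters in this form: all components of a level [r a] go into one level of [q].
    This makes [U] fix [r a], hence preserve the sign of [C]. *)

Definition lin (R : realType) (r s : R -> R) (z : R * R) : R :=
  r z.1 + s z.1 * z.2.

(** All that is used of a finite linear-like submersion. With [k] the sign of [r'] at the zero [a],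
    the last clause says that [s'] is negligible against [r'] near [a]; its difference form is what
    the estimates at the leaf consume. *)
Definition tame (R : realType) (r s : R -> R) : Prop :=
  [/\ continuous r, continuous s, finite_set [set x | s x = 0] &
      forall a, s a = 0 -> exists k : R, `|k| = 1 /\
        forall e : R, 0 < e -> exists2 d : R, 0 < d &
          forall x x', a - d < x -> x < x' -> x' < a + d ->
            0 < k * (r x' - r x) /\ `|s x' - s x| <= e * (k * (r x' - r x))].

(** * From submersions to tame pairs *)

Lemma is_derive_smooth (R : realType) (f : R -> R) (n : nat) (x : R) :
  smooth f -> is_derive x 1 (f^`(n))%classic (f^`(n.+1)%classic x).
Proof. by move=> sf; rewrite derive1nS derive1E; apply: DeriveDef; first exact: sf. Qed.

Lemma derive_lin_left (R : realType) (r s : R -> R) (x y dr ds : R) :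
  is_derive x 1 r dr -> is_derive x 1 s ds ->
  'D_(1, 0) (lin r s : R * R -> R) (x, y) = dr + y * ds.
Proof.
move=> er es; have -> : 'D_(1, 0) (lin r s : R * R -> R) (x, y) =
          'D_1 (r + y *: s) x.
  rewrite /derive; set F := (X in lim (X @ _)); set G := (X in _ = lim (X @ _)).
  suff -> : F = G by [].
  rewrite /F /G; apply/funext => h /=; rewrite /lin /= !fctE /= scaler0 add0r.
  by rewrite /GRing.scale /= ![_ * y]mulrC.
exact: (@derive_val _ _ _ _ _ _ _ (is_deriveD er (is_deriveZ y es))).
Qed.

Lemma derive_lin_right (R : realType) (r s : R -> R) (x y : R) :
  'D_(0, 1) (lin r s : R * R -> R) (x, y) = s x.
Proof.
have -> : 'D_(0, 1) (lin r s : R * R -> R) (x, y) =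
          'D_1 (cst (r x) + s x *: id) y.
  rewrite /derive; set F := (X in lim (X @ _)); set G := (X in _ = lim (X @ _)).
  suff -> : F = G by [].
  rewrite /F /G; apply/funext => h /=; rewrite /lin /= !fctE /=.
  by congr (_ *: _); rewrite scaler0 add0r.
have := @derive_val _ _ _ _ _ _ _
  (is_deriveD (is_derive_cst (r x) y 1) (is_deriveZ (s x) (is_derive_id y 1))).
by move=> ->; rewrite add0r [LHS]mulr1.
Qed.

(* At a zero of [s] the gradient is (r' + s' y, 0), so it can only avoid
   vanishing for all [y] if s' = 0 there. *)
Lemma submersion_zero (R : realType) (r s : R -> R) (a : R) :
  smooth r -> smooth s -> submersion (lin r s) -> s a = 0 ->
  s^`()%classic a = 0 /\ r^`()%classic a != 0.
Proof.
move=> sr ss sub sa.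
have key y : r^`()%classic a + y * s^`()%classic a != 0.
  have := sub (a, y); rewrite /gradient derive_lin_right sa.
  rewrite (derive_lin_left y (is_derive_smooth 0 a sr) (is_derive_smooth 0 a ss)).
  by apply: contra => /eqP ->.
have s0 : s^`()%classic a = 0.
  apply/eqP/negPn/negP => s0.
  have := key (- r^`()%classic a / s^`()%classic a).
  by rewrite divfK// subrr eqxx.
by split=> //; have := key 0; rewrite s0 mul0r addr0.
Qed.

Lemma smooth_continuous (R : realType) (f : R -> R) n :
  smooth f -> continuous (f^`(n))%classic.
Proof.
by move=> sf x; apply: differentiable_continuous; apply/derivable1_diffP/sf.
Qed.

Lemma finite_linear_like_tame (R : realType) (p : R * R -> R) :
  finite_linear_like_submersion p -> exists r s, p = lin r s /\ tame r s.
Proof.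
move=> [r [s [[sr ss pE] sub fin]]].
have pE' : p = lin r s by apply/funext => -[x y]; rewrite pE.
exists r, s; split=> //; rewrite pE' in sub; split=> //.
- exact: (@smooth_continuous _ _ 0%N).
- exact: (@smooth_continuous _ _ 0%N).
move=> a sa; have [s'0 r'0] := submersion_zero sr ss sub sa.
exists (Num.sg (r^`()%classic a)); split; first by rewrite normr_sg r'0.
set k := Num.sg _.
have kr : 0 < k * r^`()%classic a by rewrite -normrEsg normr_gt0.
move=> e e0.
have cr := @smooth_continuous _ _ 1%N sr a.
have cs := @smooth_continuous _ _ 1%N ss a.
(* By [submersion_zero] the derivative of [G b] at [a] is [e * |r' a| > 0] for every [b]. That [G 1]
   and [G (-1)] both increase near [a] is the estimate of the increments of [s] by those of [r]. *)
pose G b t := e * (k * r t) + b * s t.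
have cG (b : R) : b * s^`()%classic a = 0 -> \forall x \near a,
    0 < e * (k * r^`()%classic x) + b * s^`()%classic x.
  move=> b0.
  have : (fun x => e * (k * r^`()%classic x) + b * s^`()%classic x) @ a -->
         e * (k * r^`()%classic a) + b * s^`()%classic a.
    apply: cvgD; first by apply: cvgM; [exact: cvg_cst|apply: cvgM => //; exact: cvg_cst].
    by apply: cvgM => //; exact: cvg_cst.
  by move=> /cvgr_gt; apply; rewrite b0 addr0 mulr_gt0.
have GE (b x : R) : is_derive x 1 (G b) (e * (k * r^`()%classic x) + b * s^`()%classic x).
  have er := is_derive_smooth 0 x sr; have es := is_derive_smooth 0 x ss.
  have := is_deriveD (is_deriveZ e (is_deriveZ k er)) (is_deriveZ b es).
  exact.
have /nbhs_ballP[d /= d0 dP] : \forall x \near a,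
    0 < e * (k * r^`()%classic x) + (-1) * s^`()%classic x /\
    0 < e * (k * r^`()%classic x) + 1 * s^`()%classic x.
  by apply: filterI; apply: cG; rewrite s'0 mulr0.
exists d => // x x' ax xx' xa.
have inball t : x <= t <= x' -> ball a d t.
  by move=> /andP[xt tx]; rewrite /ball /= ltr_distl; apply/andP; lra.
have incr (b : R) : (forall t, x <= t <= x' -> 0 < e * (k * r^`()%classic t) + b * s^`()%classic t) ->
    G b x < G b x'.
  move=> H; have [|c cx Gc] := MVT_segment (ltW xx') (fun t _ => GE b t).
    by apply: continuous_subspaceT => t; apply: differentiable_continuous;
      apply/derivable1_diffP; case: (GE b t).
  by rewrite -subr_gt0 Gc mulr_gt0 ?subr_gt0// H// -in_itv.
have := incr (-1) (fun t tx => (dP t (inball t tx)).1).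
have := incr 1 (fun t tx => (dP t (inball t tx)).2).
rewrite /G => h1 h2.
have h3 : `|s x' - s x| < e * (k * (r x' - r x)).
  by rewrite ltr_norml; apply/andP; lra.
split; last exact: ltW.
by rewrite -(pmulr_rgt0 _ e0); exact: le_lt_trans h3.
Qed.

(** * Continuous functions of one real variable *)

Lemma cvg_pairR (R : realType) T (F : set_system T) {FF : Filter F}
    (f g : T -> R) (a b : R) :
  f @ F --> a -> g @ F --> b -> (fun t => (f t, g t)) @ F --> (a, b).
Proof. by move=> fa gb; exact: (@cvg_pair _ _ _ F (nbhs a) (nbhs b)). Qed.

Lemma IVT_setT (R : realType) (f : R -> R) (a b v : R) : continuous f ->
  f a <= v <= f b -> exists2 c, Num.min a b <= c <= Num.max a b & f c = v.
Proof.
move=> cf /andP[av vb].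
have [ab|ba] := leP a b.
  have [|c] := IVT (v := v) ab (continuous_subspaceT cf).
    by rewrite ge_min av/= le_max vb orbT.
  by rewrite in_itv /= => cab fc; exists c.
have [|c] := IVT (v := v) (ltW ba) (continuous_subspaceT cf).
  by rewrite ge_min av orbT/= le_max vb.
by rewrite in_itv /= => cab fc; exists c.
Qed.

Lemma continuous_injective_monotone (R : realType) (f : R -> R) :
  continuous f -> injective f ->
  (forall x y, x < y -> f x < f y) \/ (forall x y, x < y -> f y < f x).
Proof.
move=> cf inj.
have [||fm|fm] := @itv_continuous_inj_mono R f `]-oo, +oo[.
- by apply: continuous_subspaceT.
- by move=> x y _ _ /inj.
- by left=> x y xy; apply: fm; rewrite ?in_itv.
- by right=> x y xy; apply: fm; rewrite ?in_itv.
Qed.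

Lemma inverse_continuous (R : realType) (f g : R -> R) :
  continuous f -> cancel f g -> cancel g f -> continuous g.
Proof.
move=> cf fK gK x; rewrite -(gK x); have nfK : {near g x, cancel f g} by near=> t; exact: fK.
have ncf : {near g x, continuous f} by near=> t; exact: cf.
exact: nbhs_singleton (near_can_continuous nfK ncf).
Unshelve. all: by end_near.
Qed.

(** Otherwise the values at [m - d / 2] and [m + d / 2] are at most [f m], and the larger of them is
    taken again between [m] and the other end, against injectivity. *)
Lemma locally_injective_no_max (R : realType) (f : R -> R) (m d : R) :
  continuous f -> 0 < d ->
  (forall y z, `|y - m| < d -> `|z - m| < d -> f y = f z -> y = z) ->
  exists2 t, `|t - m| < d & f m < f t.
Proof.
move=> cf d0 inj.
have near_m t : m - d / 2 <= t <= m + d / 2 -> `|t - m| < d.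
  by move=> /andP[? ?]; rewrite ltr_norml; apply/andP; lra.
have [lt|fl] := ltP (f m) (f (m - d / 2)).
  by exists (m - d / 2); first by apply: near_m; apply/andP; lra.
have [lt|fr] := ltP (f m) (f (m + d / 2)).
  by exists (m + d / 2); first by apply: near_m; apply/andP; lra.
have [lr|rl] := leP (f (m - d / 2)) (f (m + d / 2)).
  have [|c cm fc] := @IVT_setT R f (m - d / 2) m (f (m + d / 2)) cf.
    by rewrite lr fr.
  have mdm : m - d / 2 <= m by lra.
  move: cm; rewrite (min_idPl mdm) (max_idPr mdm) => /andP[c1 c2].
  have : c = m + d / 2 by apply: inj => //; apply: near_m; apply/andP; lra.
  by lra.
have [|c cm fc] := @IVT_setT R f (m + d / 2) m (f (m - d / 2)) cf.
  by rewrite (ltW rl) fl.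
have mdm : m <= m + d / 2 by lra.
move: cm; rewrite (min_idPr mdm) (max_idPl mdm) => /andP[c1 c2].
have : c = m - d / 2 by apply: inj => //; apply: near_m; apply/andP; lra.
by lra.
Qed.

(** If [f a = f b], neither [f] nor [- f] can have a maximum inside [[a, b]], so that [f] is
    constant there, which local injectivity at [a] forbids. *)
Lemma locally_injective_injective (R : realType) (f : R -> R) : continuous f ->
  (forall x, exists2 d : R, 0 < d & forall y z,
     `|y - x| < d -> `|z - x| < d -> f y = f z -> y = z) ->
  injective f.
Proof.
move=> cf loc.
have nomax (g : R -> R) a b : continuous g -> (forall y z, g y = g z -> f y = f z) ->
    a < b -> g a = g b -> forall t, a <= t <= b -> g t <= g a.
  move=> cg gf ab gab.
  have [m + mP] := EVT_max (ltW ab) (continuous_subspaceT cg).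
  rewrite in_itv /= => mab.
  have [me|ma] := eqVneq m a.
    by rewrite -[in g a]me => t tab; apply: mP; rewrite in_itv.
  have [me|mb] := eqVneq m b.
    by rewrite gab -[in g b]me => t tab; apply: mP; rewrite in_itv.
  have {}ma : a < m by rewrite lt_def ma; case/andP: mab.
  have {}mb : m < b by rewrite lt_def eq_sym mb; case/andP: mab.
  have [d d0 dinj] := loc m.
  have e0 : 0 < Num.min d (Num.min (m - a) (b - m)).
    by rewrite !lt_min d0 !subr_gt0 ma mb.
  have [|t] := @locally_injective_no_max R g m _ cg e0.
    move=> y z; rewrite !lt_min => /andP[yd _] /andP[zd _] /gf.
    exact: dinj.
  rewrite !lt_min => /and3P[_ t1 t2] gt.
  have : g t <= g m.
    by apply: mP; rewrite in_itv /=; move: t1 t2; rewrite !ltr_norml => /andP[? ?] /andP[? ?]; apply/andP; lra.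
  by rewrite leNgt gt.
have main a b : a < b -> f a = f b -> False.
  move=> ab fab.
  have up := nomax f a b cf (fun _ _ => id) ab fab.
  have dn : forall t, a <= t <= b -> - f t <= - f a.
    apply: (nomax (fun t => - f t)) => //; last by rewrite fab.
      by move=> t; apply: cvgN; exact: cf.
    by move=> y z /oppr_inj.
  have cst t : a <= t <= b -> f t = f a.
    by move=> tab; apply/eqP; rewrite eq_le up//= -lerN2 dn.
  have [d d0 dinj] := loc a.
  have [t /andP[ta td] tb] : exists2 t, a < t < a + d & t <= b.
    exists (Num.min b (a + d / 2)); last by rewrite ge_min lexx.
    by rewrite lt_min ab/= gt_min ltrD2l; apply/andP; split; [|apply/orP; right]; lra.
  have : t = a; last by lra.
  apply: dinj; [by rewrite ltr_norml; apply/andP; lra|by rewrite subrr normr0|].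
  by apply: cst; rewrite tb (ltW ta).
move=> x y fxy; have [xy|yx|//] := ltgtP x y; first by case: (main x y).
by case: (main y x).
Qed.

Lemma increasing_unbounded_inverse (R : realType) (f : R -> R) :
  continuous f -> {homo f : x y / x < y} ->
  (forall M, exists x, M < f x) -> (forall M, exists x, f x < M) ->
  exists g : R -> R, [/\ cancel f g, cancel g f, continuous g & {homo g : x y / x < y}].
Proof.
move=> cf fincr up dn.
have surj y : exists x, f x = y.
  have [a fa] := dn y; have [b fb] := up y.
  have [|c _ <-] := @IVT_setT R f a b y cf; first by rewrite !ltW.
  by exists c.
have [g gK] := choice surj.
have inj : injective f.
  by move=> x y fxy; have [/fincr|/fincr|//] := ltgtP x y; rewrite fxy ltxx.
have fK : cancel f g by move=> x; apply: inj; rewrite gK.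
exists g; split=> //; first exact: inverse_continuous fK gK.
move=> x y; rewrite ltNge => /negP xy; rewrite ltNge; apply/negP => gxy.
apply: xy; rewrite -(gK x) -(gK y).
by move: gxy; rewrite le_eqVlt => /predU1P[->//|/fincr/ltW].
Qed.

(** Lying in one component of the complement of the zeros of [s]. As a relation between abscissas it
    spares any enumeration of the strips. *)
Definition strip (R : realType) (s : R -> R) (x x' : R) : Prop :=
  forall t, Num.min x x' <= t <= Num.max x x' -> s t != 0.

Section Strips.
Variables (R : realType) (s : R -> R).
Implicit Types x y z t : R.

Lemma stripl x x' : strip s x x' -> s x != 0.
Proof. by apply; rewrite ge_min le_max !lexx. Qed.

Lemma strip_refl x : s x != 0 -> strip s x x.
Proof. by move=> sx t; rewrite minxx maxxx -eq_le => /eqP <-. Qed.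

Lemma strip_sym x y : strip s x y -> strip s y x.
Proof. by rewrite /strip minC maxC. Qed.

Lemma stripr x x' : strip s x x' -> s x' != 0.
Proof. by move/strip_sym/stripl. Qed.

Lemma dist_between (x0 d x y t : R) : `|x - x0| < d -> `|y - x0| < d ->
  Num.min x y <= t <= Num.max x y -> `|t - x0| < d.
Proof.
rewrite !ltr_distl => /andP[x1 x2] /andP[y1 y2] /andP[t1 t2]; apply/andP; split.
  by apply: lt_le_trans t1; rewrite lt_min x1.
by apply: le_lt_trans t2 _; rewrite gt_max x2.
Qed.

Lemma not_strip x y : ~ strip s x y ->
  exists2 t, Num.min x y <= t <= Num.max x y & s t = 0.
Proof. by move=> /existsNP[t /not_implyP[txy /negP/negPn/eqP st]]; exists t. Qed.

End Strips.

(** * Strips and leaves *)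

(* The ordinate over [x] of the level [c]; meaningful only when [s x != 0]. *)
Definition lvl (R : realType) (r s : R -> R) (c x : R) : R := (c - r x) / s x.

(* Stands for lying in the same connected component of a level set: a strip
   meets each level in a graph, and the line over a zero of [s] is a leaf. *)
Definition same_leaf (R : realType) (r s : R -> R) (z z' : R * R) : Prop :=
  lin r s z = lin r s z' /\ (strip s z.1 z'.1 \/ s z.1 = 0 /\ z.1 = z'.1).

Section Leaves.
Variables (R : realType) (r s : R -> R).
Implicit Types (x y c : R) (z : R * R).

Lemma lin_lvl c x : s x != 0 -> lin r s (x, lvl r s c x) = c.
Proof. by move=> sx; rewrite /lin /lvl /= mulrC divfK// addrC subrK. Qed.

Lemma lvl_lin z : s z.1 != 0 -> lvl r s (lin r s z) z.1 = z.2.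
Proof. by move=> sx; rewrite /lin /lvl addrAC subrr add0r mulrAC divff// mul1r. Qed.

Lemma lin_zero z : s z.1 = 0 -> lin r s z = r z.1.
Proof. by rewrite /lin => ->; rewrite mul0r addr0. Qed.

Lemma lvlE z c : s z.1 != 0 -> lin r s z = c -> z.2 = lvl r s c z.1.
Proof. by move=> sz <-; rewrite lvl_lin. Qed.

Hypotheses (cr : continuous r) (cs : continuous s).

Lemma lin_continuous : continuous (lin r s).
Proof.
move=> z; apply: cvgD; first by apply: cvg_comp; [exact: cvg_fst|exact: cr].
by apply: cvgM; [apply: cvg_comp; [exact: cvg_fst|exact: cs]|exact: cvg_snd].
Qed.

Lemma cvg_lvl T (F : set_system T) {FF : Filter F} (f g : T -> R) c x :
  s x != 0 -> f @ F --> c -> g @ F --> x ->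
  (fun t => lvl r s (f t) (g t)) @ F --> lvl r s c x.
Proof.
move=> sx fc gx; apply: cvgM.
  by apply: cvgB => //; apply: (cvg_comp _ _ gx); exact: cr.
by apply: cvgV => //; apply: (cvg_comp _ _ gx); exact: cs.
Qed.

Lemma same_leaf_component z z' : same_leaf r s z z' ->
  connected_component (lin r s @^-1` [set lin r s z]) z z'.
Proof.
case: z z' => [x y] [x' y'] [/= lE [st|[s0 <-]]].
  pose I := `[Num.min x x', Num.max x x'].
  exists ((fun t => (t, lvl r s (lin r s (x, y)) t)) @` [set` I]).
    split.
    - exists x; first by rewrite /= in_itv /= ge_min le_max !lexx.
      by rewrite (@lvl_lin (x, y)) //; exact: stripl st.
    - move=> _ [t tI <-] /=; rewrite lin_lvl//; apply: st.
      by move: tI; rewrite /= in_itv.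
    - apply: connected_continuous_connected; first exact: segment_connected.
      apply: continuous_in_subspaceT => t; rewrite inE /= in_itv /= => /st st0.
      by apply: cvg_pairR; [exact: cvg_id|apply: cvg_lvl => //; exact: cvg_cst].
  exists x'; first by rewrite /= in_itv /= ge_min le_max !lexx !orbT.
  by rewrite lE (@lvl_lin (x', y')) //; exact: stripr st.
exists ((fun t => (x, t)) @` [set: R]); last by exists y'.
split; first by exists y.
  by move=> _ [t _ <-]; rewrite /= /lin /= s0 !mul0r.
apply: connected_continuous_connected; first exact/connected_intervalP.
by apply: continuous_subspaceT => t; apply: cvg_pairR; [exact: cvg_cst|exact: cvg_id].
Qed.

End Leaves.

Section Tame.
Variables (R : realType) (r s : R -> R).
Hypothesis rs : tame r s.
Implicit Types (x y c : R) (z : R * R).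

Lemma tame_isolated x0 : exists2 d : R, 0 < d &
  forall x, `|x - x0| < d -> x != x0 -> s x != 0.
Proof.
case: rs => _ _ fin _.
have : nbhs x0 (~` ([set x | s x = 0] `\ x0)).
  apply: open_nbhs_nbhs; split; last by move=> [_ /(_ erefl)].
  apply: closed_openC; apply: (accessible_finite_set_closed.1 _).
    by apply: hausdorff_accessible; exact: Rhausdorff.
  exact: finite_setD.
move=> /nbhs_ballP[d /= d0 dP]; exists d => // x xd xx0.
have : ball x0 d x by rewrite /ball /= distrC.
move=> /dP /= H; apply/eqP => sx; apply: H; split=> //.
exact/eqP.
Qed.

Lemma tame_strip_near x0 : s x0 != 0 -> exists2 d : R, 0 < d &
  forall x y, `|x - x0| < d -> `|y - x0| < d -> strip s x y.
Proof.
move=> sx0; have [d d0 dP] := tame_isolated x0; exists d => // x y xd yd t txy.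
have [->//|tx0] := eqVneq t x0; apply: dP => //; exact: dist_between txy.
Qed.

Lemma tame_strip_side a : exists2 d : R, 0 < d & forall x y,
  `|x - a| < d -> `|y - a| < d -> x != a -> y != a -> (x < a) = (y < a) -> strip s x y.
Proof.
have [d d0 dP] := tame_isolated a; exists d => // x y xd yd xa ya side t txy.
apply: dP; first exact: dist_between txy.
apply/eqP => ta; move: txy xa ya side; rewrite ta ge_min le_max.
by case: (ltgtP x a) => //= ?; case: (ltgtP y a) => //= ?.
Qed.

Lemma tame_at a : s a = 0 -> exists k : R, [/\ `|k| = 1, k * k = 1 &
  forall e : R, 0 < e -> exists2 d : R, 0 < d & forall x x',
    `|x - a| < d -> `|x' - a| < d ->
    [/\ x < x' -> 0 < k * (r x' - r x), `|s x' - s x| <= e * `|r x' - r x| &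
        x != a -> s x != 0]].
Proof.
move=> sa; case: rs => cr cs fin /(_ a sa)[k [k1 kP]].
have kk : k * k = 1 by rewrite -expr2 -real_normK ?num_real// k1 expr1n.
exists k; split=> // e e0; have [d1 d10 d1P] := kP _ e0.
have [d2 d20 d2P] := tame_isolated a.
exists (Num.min d1 d2); first by rewrite lt_min d10.
move=> x x'; rewrite !lt_min => /andP[xd1 xd2] /andP[xd1' xd2'].
have nk (u : R) : 0 < k * u -> `|u| = k * u.
  by move=> ku; rewrite -(ger0_norm (ltW ku)) normrM k1 mul1r.
move: xd1 xd1'; rewrite !ltr_norml => /andP[? ?] /andP[? ?].
split.
- by move=> xx'; case: (d1P x x') => //; lra.
- have [xx'|x'x|->] := ltgtP x x'; last by rewrite !subrr normr0 mulr0.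
    by have [||| h1 h2] := d1P x x' => //; [lra|lra|rewrite (nk _ h1)].
  have [||| h1 h2] := d1P x' x => //; [lra|lra|].
  by rewrite distrC (distrC (r _)) (nk _ h1).
- exact: d2P.
Qed.

(* On bounded parts of the vertical leaf above a zero the term [s x * y] is
   dominated by the variation of [r]. *)
Lemma tame_side a : s a = 0 -> exists k : R, [/\ `|k| = 1, k * k = 1 &
  forall M : R, exists2 d : R, 0 < d & forall x y, `|x - a| < d -> `|y| <= M ->
    [/\ a < x -> 0 < k * (lin r s (x, y) - r a),
        x < a -> k * (lin r s (x, y) - r a) < 0 & x != a -> s x != 0]].
Proof.
move=> sa; have [k [k1 kk kP]] := tame_at sa; exists k; split=> // M.
have M0 : 0 < `|M| + 1 by rewrite ltr_pwDr.
have [|d d0 dP] := kP ((`|M| + 1)^-1 / 2); first by rewrite divr_gt0 ?invr_gt0.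
exists d => // x y xd yM.
have ad : `|a - a| < d by rewrite subrr normr0.
have yM' : `|y| <= `|M| + 1 by apply: (le_trans yM); rewrite ler_wpDr// ler_norm.
have [p1 p2 p3] := dP _ _ xd ad; have [q1 q2 q3] := dP _ _ ad xd.
have bound : `|s x * y| <= `|r x - r a| / 2.
  move: q2; rewrite sa subr0 normrM => q2.
  apply: (@le_trans _ _ ((`|M| + 1)^-1 / 2 * `|r x - r a| * (`|M| + 1))).
    by apply: ler_pM => //; apply: mulr_ge0.
  by rewrite mulrAC [_ / 2 * _]mulrAC mulVf ?gt_eqF// mul1r mulrC.
have kb : `|k * (s x * y)| <= `|r x - r a| / 2 by rewrite normrM k1 mul1r.
have kr : `|k * (r x - r a)| = `|r x - r a| by rewrite normrM k1 mul1r.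
have E : k * (lin r s (x, y) - r a) = k * (r x - r a) + k * (s x * y).
  by rewrite /lin /=; ring.
split=> //; rewrite E.
- move=> /q1 h; move: kb; rewrite -kr (gtr0_norm h) ler_norml => /andP[? ?]; lra.
- move=> /p1; have -> : k * (r a - r x) = - (k * (r x - r a)) by ring.
  rewrite oppr_gt0 => h; move: kb; rewrite -kr (ltr0_norm h) ler_norml => /andP[? ?]; lra.
Qed.

(** Near a point of a vertical leaf, [tame_side] gives [k * (lin r s z - r x0)] the sign of
    [z.1 - x0], so that two points of equal level are on the same side of the leaf, or both on it.
    This is what makes value maps locally injective even where an image crosses a vertical leaf. *)
Lemma same_leaf_near z0 : exists2 d : R, 0 < d & forall z z',
  `|z.1 - z0.1| < d -> `|z.2 - z0.2| < d -> `|z'.1 - z0.1| < d -> `|z'.2 - z0.2| < d ->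
  lin r s z = lin r s z' -> same_leaf r s z z'.
Proof.
case: z0 => x0 y0 /=.
have [sx0|sx0] := eqVneq (s x0) 0; last first.
  have [d d0 dP] := tame_strip_near sx0.
  by exists d => // -[x y] [x' y'] /= xd _ xd' _ lE; split=> //; left; exact: dP.
have [d1 d10 d1P] := tame_strip_side x0.
have [k [k1 kk kP]] := tame_side sx0.
have [d d0 dP] := kP (`|y0| + 1).
exists (Num.min d (Num.min d1 1)); first by rewrite !lt_min d0 d10 ltr01.
move=> [x y] [x' y'] /=; rewrite !lt_min.
move=> /and3P[xd xd1 _] /and3P[_ _ yd] /and3P[xd' xd1' _] /and3P[_ _ yd'] lE.
have yb (u : R) : `|u - y0| < 1 -> `|u| <= `|y0| + 1.
  move=> h; rewrite -(subrK y0 u); apply: (le_trans (ler_normD _ _)).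
  by rewrite addrC lerD2l ltW.
have [g l n] := dP _ _ xd (yb _ yd); have [g' l' n'] := dP _ _ xd' (yb _ yd').
split=> //=.
have zero : lin r s (x0, y0) = r x0 by rewrite lin_zero.
have [xlt|xgt|xe] := ltgtP x x0; have [xlt'|xgt'|xe'] := ltgtP x' x0.
- by left; apply: d1P; rewrite ?lt_eqF// xlt xlt'.
- by move: (l xlt) (g' xgt'); rewrite lE => h1 h2; have := lt_trans h1 h2; rewrite ltxx.
- by move: (l xlt); rewrite lE xe' lin_zero// subrr mulr0 ltxx.
- by move: (l' xlt') (g xgt); rewrite lE => h1 h2; have := lt_trans h1 h2; rewrite ltxx.
- by left; apply: d1P; rewrite ?gt_eqF// !ltNge !ltW.
- by move: (g xgt); rewrite lE xe' lin_zero// subrr mulr0 ltxx.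
- by move: (l' xlt'); rewrite -lE xe lin_zero// subrr mulr0 ltxx.
- by move: (g' xgt'); rewrite -lE xe lin_zero// subrr mulr0 ltxx.
- by right; rewrite xe xe'.
Qed.

End Tame.

(** * Moving a strip along its levels, as the identity on the vertical leaves *)

(** Pasting along [u = v]: a branch has to converge only if the limit lies on its closed side, so
    that a branch with a vanishing denominator may be ignored beyond the seam. *)
Lemma cvg_glue (R : realType) (T : Type) (F : set_system T) {FF : Filter F}
    (u v A B : T -> R) (u0 v0 L : R) :
  u @ F --> u0 -> v @ F --> v0 ->
  (u0 <= v0 -> A @ F --> L) -> (v0 <= u0 -> B @ F --> L) ->
  (fun x => if u x <= v x then A x else B x) @ F --> L.
Proof.
move=> uu vv HA HB.
have vu : (fun x => v x - u x) @ F --> v0 - u0 by apply: cvgB.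
have [lt|gt|e] := ltgtP u0 v0.
- apply: cvg_trans (HA (ltW lt)); apply: near_eq_cvg.
  have p : 0 < v0 - u0 by rewrite subr_gt0.
  have h : \forall x \near F, 0 < v x - u x by move/cvgr_gt: vu; apply.
  apply: filterS h => x; rewrite subr_gt0.
  by move=> /ltW ->.
- apply: cvg_trans (HB (ltW gt)); apply: near_eq_cvg.
  have p : v0 - u0 < 0 by rewrite subr_lt0.
  have h : \forall x \near F, v x - u x < 0 by move/cvgr_lt: vu; apply.
  apply: filterS h => x; rewrite subr_lt0.
  by rewrite ltNge => /negbTE ->.
- have {}HA : A @ F --> L by apply: HA; rewrite e.
  have {}HB : B @ F --> L by apply: HB; rewrite e.
  move=> N NL; have HAN : F (A @^-1` N) := HA _ NL.
  have HBN : F (B @^-1` N) := HB _ NL.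
  suff : F [set x | N (if u x <= v x then A x else B x)] by [].
  by apply: filterS (filterI HAN HBN) => x /= [? ?]; case: ifP.
Qed.

(* Increasing parametrizations of the part [t > 0] of the level [C] of the model
   [t + S t * y], with [q] standing for [S C]; the leaf crosses [y = 0] at
   [t = C].  The range, [w > -1] for [C > 0] and [w > 1] for [C = 0], depends
   only on the sign of [C], so that they can be composed between levels of the
   same sign, and the result is the identity for [t >= D].  On
   [0 < t <= 2 C] the quantity [q (1 / |t - C| - 1 / C)] becomes [1 / |w| - 1],
   so that [w] tends to [- y / (1 + |y|)] close to the vertical leaf [t = 0]. *)
Definition chart (R : realType) (D C q t : R) : R :=
  if t <= 2 * C then (t - C) / (q * (1 - `|t - C| / C) + `|t - C|)
  else if t <= D then 1 + (t - 2 * C) / (D - 2 * C) else 2 + (t - D).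

Definition unchart (R : realType) (D C q w : R) : R :=
  if w <= 1 then C + q * w / (1 - `|w| + q * `|w| / C)
  else if w <= 2 then 2 * C + (w - 1) * (D - 2 * C) else D + (w - 2).

Section Chart.
Variables (R : realType) (D C q : R).
Hypotheses (D0 : 0 < D) (C0 : 0 <= C) (CD : 4 * C <= D) (q0 : 0 < C -> 0 < q).

Definition chart_range (w : R) := if 0 < C then -1 < w else 1 < w.

Implicit Types t w : R.

Let C_gt0 t : 0 < t -> t <= 2 * C -> 0 < C.
Proof. by move=> t0 t1; rewrite lt_def C0 andbT; apply/eqP => c0; move: t1; rewrite c0; lra. Qed.

Let dist_le t : 0 < t -> t <= 2 * C -> `|t - C| <= C.
Proof. by move=> t0 t1; rewrite ler_norml; apply/andP; lra. Qed.

Lemma chart_den_gt0 t : 0 < t -> t <= 2 * C -> 0 < q * (1 - `|t - C| / C) + `|t - C|.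
Proof.
move=> t0 t1; have c := C_gt0 t0 t1; have d := dist_le t0 t1.
have [e|ne] := eqVneq `|t - C| C; first by rewrite e divff ?gt_eqF// subrr mulr0 add0r.
by rewrite ltr_pwDl// mulr_gt0 ?q0// subr_gt0 ltr_pdivrMr// mul1r lt_def eq_sym ne.
Qed.

Lemma unchart_den_gt0 w : 0 < C -> -1 < w -> w <= 1 -> 0 < 1 - `|w| + q * `|w| / C.
Proof.
move=> c w1 w2; have d : `|w| <= 1 by rewrite ler_norml w2 ltW.
have qq := q0 c.
have [e|ne] := eqVneq `|w| 1; first by rewrite e subrr add0r mulr1 divr_gt0.
rewrite ltr_pwDl//; first by rewrite subr_gt0 lt_def eq_sym ne.
by rewrite divr_ge0 ?mulr_ge0// ltW.
Qed.

Let chart_low t : 0 < t -> t <= 2 * C ->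
  -1 < (t - C) / (q * (1 - `|t - C| / C) + `|t - C|) <= 1.
Proof.
move=> t0 t1; have c := C_gt0 t0 t1; have d := dist_le t0 t1.
have dg := chart_den_gt0 t0 t1.
have n0 : 0 <= q * (1 - `|t - C| / C).
  by rewrite mulr_ge0 ?(ltW (q0 c))// subr_ge0 ler_pdivrMr// mul1r.
rewrite ltr_pdivlMr// ler_pdivrMr// mul1r mulN1r; apply/andP; split; last first.
  by apply: (le_trans (ler_norm _)); rewrite lerDr.
rewrite ltrNl opprB.
have [->|tC] := eqVneq t C; first by rewrite !subrr normr0 mul0r subr0 mulr1 addr0 q0.
have [tc|tc] := leP C t.
  have lt : C < t by rewrite lt_def tC.
  by have := normr_ge0 (t - C); lra.
have e : `|t - C| = C - t by rewrite ltr0_norm ?opprB// subr_lt0.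
rewrite -e ltrDr mulr_gt0 ?q0// subr_gt0 ltr_pdivrMr// mul1r e; lra.
Qed.

Lemma chart_in_range t : 0 < t -> chart_range (chart D C q t).
Proof.
move: (D0) (C0) (CD) => D0' C0' CD'.
move=> t0; rewrite /chart /chart_range; have [t1|t1] := leP t (2 * C).
  by rewrite (C_gt0 t0 t1); case/andP: (chart_low t0 t1).
have dp : 0 < D - 2 * C by lra.
suff : 1 < if t <= D then 1 + (t - 2 * C) / (D - 2 * C) else 2 + (t - D).
  by case: ifP => // _ h; case: ifP; lra.
case: ifP => [tD|/negbT]; last by rewrite -ltNge; lra.
by rewrite ltrDl divr_gt0// subr_gt0.
Qed.

Let unchart_low w : 0 < C -> -1 < w -> w <= 1 ->
  - C < q * w / (1 - `|w| + q * `|w| / C) <= C.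
Proof.
move=> c w1 w2; have dg := unchart_den_gt0 c w1 w2; have qq := q0 c.
have E : C * (1 - `|w| + q * `|w| / C) = C * (1 - `|w|) + q * `|w|.
  by field; rewrite gt_eqF.
have dw : `|w| <= 1 by rewrite ler_norml w2 ltW.
rewrite ltr_pdivlMr// ler_pdivrMr// mulNr E; apply/andP; split; last first.
  have : 0 <= C * (1 - `|w|) by rewrite mulr_ge0 ?(ltW c) ?subr_ge0.
  by have : q * w <= q * `|w|; [rewrite ler_pM2l// ler_norm|lra].
have [w0|w0] := leP 0 w.
  have : 0 < C * (1 - `|w| + q * `|w| / C) by rewrite mulr_gt0.
  rewrite E => ?; have : 0 <= q * w by rewrite mulr_ge0 ?(ltW qq).
  by lra.
rewrite ltr0_norm//; have : 0 < C * (1 - - w) by rewrite mulr_gt0//; lra.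
by lra.
Qed.

Lemma unchart_gt0 w : chart_range w -> 0 < unchart D C q w.
Proof.
move: (D0) (C0) (CD) => D0' C0' CD'.
rewrite /chart_range /unchart => wr; have [w1|w1] := leP w 1.
  move: wr; case: ifP => [c wr|_]; last by rewrite ltNge w1.
  by case/andP: (unchart_low c wr w1); lra.
have [w2|w2] := leP w 2; last by lra.
rewrite ltr_wpDl//; first lra.
by rewrite mulr_gt0//; lra.
Qed.

Lemma chartK t : 0 < t -> unchart D C q (chart D C q t) = t.
Proof.
move: (D0) (C0) (CD) => D0' C0' CD'.
move=> t0; rewrite /chart; have [t1|t1] := leP t (2 * C).
  have c := C_gt0 t0 t1; have /andP[w1 w2] := chart_low t0 t1.
  rewrite /unchart w2; have dg := chart_den_gt0 t0 t1.
  have cn : C != 0 by rewrite gt_eqF.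
  have qn : q != 0 by rewrite gt_eqF// q0.
  rewrite normf_div (gtr0_norm dg).
  set u := _ + `|_| in dg *; have u0 : u != 0 by rewrite gt_eqF.
  (* The relation [1 / |w| - 1 = q (1 / |t - C| - 1 / C)] cleared of denominators, so that [t = C]
     is included. *)
  have -> : 1 - `|t - C| / u + q * (`|t - C| / u) / C = q / u.
    apply: (mulIf u0); rewrite divfK//.
    rewrite [in X in _ = X](_ : q = u - `|t - C| + q * `|t - C| / C).
      by field; rewrite u0 cn.
    by rewrite /u; field; rewrite cn.
  by field; rewrite u0 qn.
have dp : 0 < D - 2 * C by lra.
have [tD|tD] := leP t D.
  have a1 : 0 < (t - 2 * C) / (D - 2 * C) by rewrite divr_gt0// subr_gt0.
  have a2 : (t - 2 * C) / (D - 2 * C) <= 1 by rewrite ler_pdivrMr// mul1r; lra.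
  rewrite /unchart ifF; last by apply/negbTE; rewrite -ltNge; lra.
  rewrite ifT; last by lra.
  by rewrite [1 + _]addrC addrK divfK ?gt_eqF//; ring.
rewrite /unchart ifF; last by apply/negbTE; rewrite -ltNge; lra.
by rewrite ifF; [ring|apply/negbTE; rewrite -ltNge; lra].
Qed.

Lemma unchartK w : chart_range w -> chart D C q (unchart D C q w) = w.
Proof.
move: (D0) (C0) (CD) => D0' C0' CD'.
move=> wr; have dp : 0 < D - 2 * C by lra.
rewrite /unchart; have [w1|w1] := leP w 1.
  move: wr; rewrite /chart_range; case: ifP => [c wr|_]; last by rewrite ltNge w1.
  have dg := unchart_den_gt0 c wr w1; have /andP[lo hi] := unchart_low c wr w1.
  have cn : C != 0 by rewrite gt_eqF.
  have qg := q0 c; have qn : q != 0 by rewrite gt_eqF.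
  rewrite /chart ifT; last by lra.
  rewrite [C + _]addrC addrK normf_div (gtr0_norm dg) normrM (gtr0_norm qg).
  set u := 1 - _ + _ in dg *; have u0 : u != 0 by rewrite gt_eqF.
  have -> : q * (1 - q * `|w| / u / C) + q * `|w| / u = q / u.
    apply: (mulIf u0); rewrite divfK//.
    rewrite (_ : (_ + _) * u = q * (u - q * `|w| / C + `|w|)); last by field; rewrite u0 cn.
    by rewrite /u; ring.
  by field; rewrite u0 qn.
have [w2|w2] := leP w 2.
  have a1 : 0 < (w - 1) * (D - 2 * C) by rewrite mulr_gt0// subr_gt0.
  have a2 : (w - 1) * (D - 2 * C) <= D - 2 * C.
    by rewrite ler_piMl ?(ltW dp)//; lra.
  rewrite /chart ifF; last by apply/negbTE; rewrite -ltNge; lra.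
  rewrite ifT; last by lra.
  by rewrite [2 * C + _]addrC addrK mulfK ?gt_eqF//; ring.
rewrite /chart ifF; last by apply/negbTE; rewrite -ltNge; lra.
by rewrite ifF; [ring|apply/negbTE; rewrite -ltNge; lra].
Qed.

(** The value involves neither [C] nor [q], so that passing from one level to another is the
    identity beyond [D]. *)
Lemma chart_high t : D <= t -> chart D C q t = 2 + (t - D).
Proof.
move: (D0) (C0) (CD) => D0' C0' CD'.
move=> Dt; rewrite /chart ifF; last by apply/negbTE; rewrite -ltNge; lra.
have [tD|//] := leP t D; have -> : t = D by apply/eqP; rewrite eq_le tD.
have dn : D - 2 * C != 0 by rewrite gt_eqF//; lra.
by rewrite divff//; ring.
Qed.

Lemma unchart_high w : 2 <= w -> unchart D C q w = D + (w - 2).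
Proof.
move=> w2; rewrite /unchart ifF; last by apply/negbTE; rewrite -ltNge; lra.
have [w2'|//] := leP w 2; have -> : w = 2 by apply/eqP; rewrite eq_le w2'.
by ring.
Qed.

Lemma chart_lt2 t : t < D -> 0 < t -> chart D C q t < 2.
Proof.
move: (D0) (C0) (CD) => D0' C0' CD'.
move=> tD t0; rewrite /chart; have [t1|t1] := leP t (2 * C).
  by case/andP: (chart_low t0 t1); lra.
rewrite (ltW tD); suff : (t - 2 * C) / (D - 2 * C) < 1 by lra.
by rewrite ltr_pdivrMr ?mul1r; lra.
Qed.

Lemma unchart_ltD w : w < 2 -> chart_range w -> unchart D C q w < D.
Proof.
move: (D0) (C0) (CD) => D0' C0' CD'.
move=> w2; rewrite /chart_range /unchart; have [w1|w1] := leP w 1.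
  case: ifP => [c wr|_ //].
  by case/andP: (unchart_low c wr w1); lra.
move=> _; rewrite (ltW w2).
have : (w - 1) * (D - 2 * C) < D - 2 * C by rewrite gtr_pMl; lra.
lra.
Qed.

End Chart.

(** * Joint continuity of the charts in the level and the parameter *)

Section ChartContinuity.
Variables (R : realType) (T : Type) (F : set_system T).
Context {FF : Filter F}.
Variables (D C0 q0 : R) (C q : T -> R).
Hypotheses (D_gt0 : 0 < D) (C0_ge0 : 0 <= C0) (C0D : 4 * C0 <= D)
  (q0_gt0 : 0 < C0 -> 0 < q0).
Hypotheses (Ccvg : C @ F --> C0) (qcvg : q @ F --> q0).

(** For [C0 = 0] the limit [t0 > 0] lies strictly beyond the seam [2 * C0], so that the branch
    dividing by [C] plays no part. In [cvg_unchart] the condition [chart_range] has the same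
    effect. *)
Lemma cvg_chart (t : T -> R) (t0 : R) : 0 < t0 -> t @ F --> t0 ->
  (fun x => chart D (C x) (q x) (t x)) @ F --> chart D C0 q0 t0.
Proof.
move: (D_gt0) (C0_ge0) (C0D) => D_gt0' C0_ge0' C0D'.
move=> t0_gt0 tt; have dp : D - 2 * C0 != 0 by rewrite gt_eqF; lra.
have C2 : (fun x => 2 * C x) @ F --> 2 * C0 by apply: cvgM => //; exact: cvg_cst.
have tC : (fun x => t x - C x) @ F --> t0 - C0 by apply: cvgB.
have ntC : (fun x => `|t x - C x|) @ F --> `|t0 - C0| by apply: cvg_norm.
rewrite /chart; apply: (cvg_glue tt C2) => [h|h].
  have c : 0 < C0 by lra.
  rewrite h; apply: cvgM => //; apply: cvgV.
    by rewrite gt_eqF// chart_den_gt0.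
  apply: cvgD => //; apply: cvgM => //; apply: cvgB; first exact: cvg_cst.
  by apply: cvgM => //; apply: cvgV => //; rewrite gt_eqF.
(* At the seam [t0 = 2 * C0] both formulas give 1. *)
have -> : (if t0 <= 2 * C0 then (t0 - C0) / (q0 * (1 - `|t0 - C0| / C0) + `|t0 - C0|)
    else if t0 <= D then 1 + (t0 - 2 * C0) / (D - 2 * C0) else 2 + (t0 - D)) =
    if t0 <= D then 1 + (t0 - 2 * C0) / (D - 2 * C0) else 2 + (t0 - D).
  have [le|//] := leP t0 (2 * C0).
  have e : t0 = 2 * C0 by apply/eqP; rewrite eq_le le.
  have c : 0 < C0 by lra.
  rewrite ifT; last by lra.
  have -> : t0 - C0 = C0 by rewrite e; ring.
  by rewrite gtr0_norm// divff ?gt_eqF// !subrr e subrr mulr0 mul0r add0r addr0 divff ?gt_eqF.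
have tD : (fun x => 2 + (t x - D)) @ F --> 2 + (t0 - D).
  by apply: cvgD; [exact: cvg_cst|apply: cvgB => //; exact: cvg_cst].
have tm : (fun x => 1 + (t x - 2 * C x) / (D - 2 * C x)) @ F -->
    1 + (t0 - 2 * C0) / (D - 2 * C0).
  apply: cvgD; first exact: cvg_cst.
  apply: cvgM; first exact: cvgB.
  by apply: cvgV => //; apply: cvgB => //; exact: cvg_cst.
apply: (cvg_glue tt (cvg_cst D)) => [h'|h']; first by rewrite h'.
have [le|//] := leP t0 D.
have -> : 1 + (t0 - 2 * C0) / (D - 2 * C0) = 2 + (t0 - D) => //.
by rewrite (_ : t0 = D); [rewrite divff//; ring|apply/eqP; rewrite eq_le le].
Qed.

Lemma cvg_unchart (w : T -> R) (w0 : R) : chart_range C0 w0 -> w @ F --> w0 ->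
  (fun x => unchart D (C x) (q x) (w x)) @ F --> unchart D C0 q0 w0.
Proof.
move: (D_gt0) (C0_ge0) (C0D) => D_gt0' C0_ge0' C0D'.
move=> wr ww.
have C2 : (fun x => 2 * C x) @ F --> 2 * C0 by apply: cvgM => //; exact: cvg_cst.
have nw : (fun x => `|w x|) @ F --> `|w0| by apply: cvg_norm.
rewrite /unchart; apply: (cvg_glue ww (cvg_cst (1 : R))) => [h|h].
  move: wr; rewrite /chart_range; case: ifP => [c wr|_]; last by rewrite ltNge h.
  rewrite h; apply: cvgD => //; apply: cvgM; first exact: cvgM.
  apply: cvgV; first by rewrite gt_eqF// unchart_den_gt0.
  apply: cvgD; first by apply: cvgB => //; exact: cvg_cst.
  apply: cvgM; first exact: cvgM.
  by apply: cvgV => //; rewrite gt_eqF.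
have tm : (fun x => 2 * C x + (w x - 1) * (D - 2 * C x)) @ F -->
    2 * C0 + (w0 - 1) * (D - 2 * C0).
  apply: cvgD => //; apply: cvgM; first by apply: cvgB => //; exact: cvg_cst.
  by apply: cvgB => //; exact: cvg_cst.
have tD : (fun x => D + (w x - 2)) @ F --> D + (w0 - 2).
  by apply: cvgD; [exact: cvg_cst|apply: cvgB => //; exact: cvg_cst].
have -> : (if w0 <= 1 then C0 + q0 * w0 / (1 - `|w0| + q0 * `|w0| / C0)
    else if w0 <= 2 then 2 * C0 + (w0 - 1) * (D - 2 * C0) else D + (w0 - 2)) =
    if w0 <= 2 then 2 * C0 + (w0 - 1) * (D - 2 * C0) else D + (w0 - 2).
  have [le|//] := leP w0 1.
  have e : w0 = 1 by apply/eqP; rewrite eq_le le.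
  move: wr; rewrite /chart_range e; case: ifP => [c _|_]; last by rewrite ltxx.
  have cn : C0 != 0 by rewrite gt_eqF.
  have qn : q0 != 0 by rewrite gt_eqF// q0_gt0.
  rewrite ifT; last by lra.
  by rewrite normr1; field; rewrite cn qn.
apply: (cvg_glue ww (cvg_cst (2 : R))) => [h'|h']; first by rewrite h'.
have [le|//] := leP w0 2.
have -> : 2 * C0 + (w0 - 1) * (D - 2 * C0) = D + (w0 - 2) => //.
by rewrite (_ : w0 = 2); [ring|apply/eqP; rewrite eq_le le].
Qed.

End ChartContinuity.

(** * Asymptotics of the charts at the vertical leaf *)

Section NearLeaf.
Variables (R : realType) (S : R -> R) (D : R).
Hypotheses (D_gt0 : 0 < D) (S0 : S 0 = 0)
  (S_gt0 : forall t, 0 < t -> t <= D -> 0 < S t)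
  (S_lip : forall e : R, 0 < e -> exists2 d : R, 0 < d &
     forall t t', 0 <= t -> t < d -> 0 <= t' -> t' < d ->
       `|S t - S t'| <= e * `|t - t'|).
Variables (T : Type) (F : set_system T).
Context {FF : Filter F}.

Lemma cvg_S_div (t : T -> R) : t @ F --> (0 : R) -> (\forall x \near F, 0 < t x) ->
  (fun x => S (t x) / t x) @ F --> (0 : R).
Proof.
move=> t0 tp; apply/cvgr0Pnorm_le => e e0.
have [d d0 dP] := S_lip e0.
have td : \forall x \near F, t x < d by move/cvgr_lt: t0; apply.
apply: filterS (filterI tp td) => x [/= xp xd].
rewrite normf_div (gtr0_norm xp) ler_pdivrMr//.
by have := dP (t x) 0 (ltW xp) xd (lexx _) d0; rewrite S0 !subr0 (gtr0_norm xp).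
Qed.

(** The boundedness of [(u - v) / S v] turns [|S u - S v| <= e * |u - v|] into a bound by a multiple
    of [e * S v]. This is where the Lipschitz form of the smallness of [S] is essential. *)
Lemma cvg_S_ratio (u v : T -> R) (l : R) :
  u @ F --> (0 : R) -> v @ F --> (0 : R) ->
  (\forall x \near F, 0 < u x) -> (\forall x \near F, 0 < v x) ->
  (fun x => (u x - v x) / S (v x)) @ F --> l ->
  (fun x => S (u x) / S (v x)) @ F --> (1 : R).
Proof.
move=> u0 v0 up vp uvl.
have l1 : 0 < `|l| + 1 by rewrite ltr_pwDr.
have vD : \forall x \near F, v x < D by move/cvgr_lt: v0; apply.
have bnd : \forall x \near F, `|(u x - v x) / S (v x)| < `|l| + 1.
  by move/cvg_norm/cvgr_lt: uvl; apply; rewrite ltrDl.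
have key : (fun x => S (u x) / S (v x) - 1) @ F --> (0 : R).
  apply/cvgr0Pnorm_le => e e0.
  have e'0 : 0 < e / (`|l| + 1) by rewrite divr_gt0.
  have [d d0 dP] := S_lip e'0.
  have ud : \forall x \near F, u x < d by move/cvgr_lt: u0; apply.
  have vd : \forall x \near F, v x < d by move/cvgr_lt: v0; apply.
  apply: filterS (filterI (filterI (filterI up vp) (filterI ud vd)) (filterI vD bnd)).
  move=> x [[[/= xu xv] [xud xvd]] [xvD xb]].
  have Sv : 0 < S (v x) by rewrite S_gt0// ltW.
  rewrite -[1](divff (lt0r_neq0 Sv)) -mulrBl normf_div (gtr0_norm Sv) ler_pdivrMr//.
  apply: (le_trans (dP _ _ (ltW xu) xud (ltW xv) xvd)).
  move: xb; rewrite normf_div (gtr0_norm Sv) ltr_pdivrMr// => xb.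
  rewrite -mulrA ler_pM2l// ler_pdivrMl//; exact: ltW.
have : (fun x => S (u x) / S (v x) - 1 + 1) @ F --> (0 + 1 : R).
  by apply: cvgD => //; exact: cvg_cst.
by rewrite add0r; apply: cvg_trans; apply: near_eq_cvg; apply: nearW => x /=; rewrite subrK.
Qed.

(* [(C - t) / S t] is the second coordinate [y] of the point of the level [C]. *)
Lemma cvg_chart_near (t C : T -> R) (y0 : R) :
  t @ F --> (0 : R) -> (\forall x \near F, 0 < t x) ->
  (fun x => (C x - t x) / S (t x)) @ F --> y0 ->
  [/\ C @ F --> (0 : R), \forall x \near F, 0 < C x &
    (fun x => chart D (C x) (S (C x)) (t x)) @ F --> - y0 / (1 + `|y0|)].
Proof.
move=> t0 tp yl.
have tD : \forall x \near F, t x < D by move/cvgr_lt: t0; apply.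
have good : \forall x \near F, [/\ 0 < t x, t x != 0 & S (t x) != 0].
  apply: filterS (filterI tp tD) => x [/= xp xD]; split=> //; first by rewrite gt_eqF.
  by rewrite gt_eqF// S_gt0// ltW.
(* This quotient is the bounded [y] times [S t / t], hence tends to 0. So [C] and [t] are
   asymptotic, and [t <= 2 * C] finally selects the first branch of [chart]. *)
have Ct0 : (fun x => (C x - t x) / t x) @ F --> (0 : R).
  have : (fun x => (C x - t x) / S (t x) * (S (t x) / t x)) @ F --> y0 * 0.
    by apply: cvgM => //; exact: cvg_S_div.
  rewrite mulr0; apply: cvg_trans; apply: near_eq_cvg.
  by apply: filterS good => x [_ tn Sn]; rewrite mulrA divfK.
have Ct : (fun x => C x / t x) @ F --> (1 : R).
  have : (fun x => (C x - t x) / t x + 1) @ F --> (0 + 1 : R).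
    by apply: cvgD => //; exact: cvg_cst.
  rewrite add0r; apply: cvg_trans; apply: near_eq_cvg.
  by apply: filterS good => x [_ tn _]; rewrite mulrBl divff// subrK.
have C0 : C @ F --> (0 : R).
  have : (fun x => C x / t x * t x) @ F --> (1 * 0 : R) by apply: cvgM.
  rewrite mulr0; apply: cvg_trans; apply: near_eq_cvg.
  by apply: filterS good => x [_ tn _]; rewrite divfK.
have Cbig : \forall x \near F, 2^-1 < C x / t x.
  by move/cvgr_gt: Ct; apply; rewrite invf_lt1// ltr1n.
have Cp : \forall x \near F, 0 < C x /\ t x <= 2 * C x.
  apply: filterS (filterI tp Cbig) => x [/= xp]; rewrite ltr_pdivlMr// => h.
  by split; lra.
have Cp1 : \forall x \near F, 0 < C x by apply: filterS Cp => x [].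
split=> //.
have SC : (fun x => S (C x) / S (t x)) @ F --> (1 : R) by apply: cvg_S_ratio yl.
have tC0 : (fun x => `|t x - C x| / C x) @ F --> (0 : R).
  have : (fun x => `|(C x - t x) / t x| / (C x / t x)) @ F --> `|0 : R| / (1 : R).
    apply: (cvgM (cvg_norm Ct0)).
    by apply: cvgV => //; exact: oner_neq0.
  rewrite normr0 mul0r; apply: cvg_trans; apply: near_eq_cvg.
  apply: filterS (filterI good Cp) => x [[xp tn _] [cp _]].
  have cn : C x != 0 by rewrite gt_eqF.
  by rewrite normf_div (gtr0_norm xp) distrC; field; rewrite cn tn.
(* Numerator and denominator of the first branch, both divided by [S t], become functions of [y], of
   [S C / S t -> 1] and of [|t - C| / C -> 0]. *)
have : (fun x => - ((C x - t x) / S (t x)) /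
     (S (C x) / S (t x) * (1 - `|t x - C x| / C x) + `|(C x - t x) / S (t x)|)) @ F
     --> - y0 / (1 * (1 - 0) + `|y0|).
  apply: cvgM; first exact: cvgN.
  apply: cvgV; first by rewrite subr0 mulr1 gt_eqF// ltr_pwDl.
  apply: cvgD; last exact: cvg_norm.
  by apply: cvgM => //; apply: cvgB => //; exact: cvg_cst.
rewrite subr0 mulr1; apply: cvg_trans; apply: near_eq_cvg.
apply: filterS (filterI (filterI tp tD) Cp) => x [[/= xp xD] [cp tc]].
have Sp : 0 < S (t x) by rewrite S_gt0// ltW.
have Sn : S (t x) != 0 by rewrite gt_eqF.
rewrite /chart tc normf_div (gtr0_norm Sp) [in RHS]distrC.
set n := `|C x - t x|; set q := S (C x).
have -> : S (C x) / S (t x) * (1 - `|t x - C x| / C x) + n / S (t x) =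
    (q * (1 - `|t x - C x| / C x) + n) / S (t x).
  by rewrite mulrDl /q mulrAC.
rewrite distrC -/n; set d := q * _ + n.
have [->|dn] := eqVneq d 0; first by rewrite mul0r !invr0 !mulr0.
by field; rewrite Sn dn.
Qed.

(** Finally [t = C + S C * tau], where [tau] differs from [w / (1 - |w|)] by a term in
    [S C / C -> 0]. As [w / (1 - |w|)] inverts [y / (1 + |y|)], [tau] tends to [- y0]; then
    [S t / S C -> 1] replaces the denominator [S C] by [S t]. *)
Lemma cvg_unchart_near (w C : T -> R) (y0 : R) :
  C @ F --> (0 : R) -> (\forall x \near F, 0 < C x) ->
  w @ F --> - y0 / (1 + `|y0|) ->
  let t x := unchart D (C x) (S (C x)) (w x) in
  [/\ t @ F --> (0 : R), \forall x \near F, 0 < t x &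
    (fun x => (C x - t x) / S (t x)) @ F --> y0].
Proof.
move=> C0 Cp wl t.
have y1 : 0 < 1 + `|y0| by rewrite ltr_pwDl.
have w0n : `|- y0 / (1 + `|y0|)| = `|y0| / (1 + `|y0|).
  by rewrite normf_div normrN (gtr0_norm y1).
have w1 : \forall x \near F, `|w x| < 1.
  by move/cvg_norm/cvgr_lt: wl; apply; rewrite w0n ltr_pdivrMr// mul1r ltrDr.
have CD : \forall x \near F, C x < D by move/cvgr_lt: C0; apply.
pose tau x := w x / (1 - `|w x| + S (C x) / C x * `|w x|).
have SC := cvg_S_div C0 Cp.
have tauE : \forall x \near F, t x = C x + S (C x) * tau x.
  apply: filterS w1 => x /= h; rewrite /t /unchart ifT.
    by rewrite /tau; congr (_ + _); rewrite mulrA; congr (_ / (_ + _)); ring.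
  exact: (le_trans (ler_norm _) (ltW h)).
have taul : tau @ F --> - y0.
  have -> : - y0 = - y0 / (1 + `|y0|) /
      (1 - `|- y0 / (1 + `|y0|)| + 0 * `|- y0 / (1 + `|y0|)|).
    by rewrite w0n mul0r addr0; field; rewrite gt_eqF//= addrK oner_neq0.
  have nw : (fun x => `|w x|) @ F --> `|- y0 / (1 + `|y0|)| by apply: cvg_norm.
  apply: cvgM => //; apply: cvgV.
    rewrite mul0r addr0 w0n gt_eqF// subr_gt0 ltr_pdivrMr// mul1r ltrDr//.
  by apply: cvgD; [apply: (cvgB (cvg_cst _) nw)|exact: (cvgM SC nw)].
have tC : (fun x => 1 + S (C x) / C x * tau x) @ F --> (1 + 0 * - y0 : R).
  by apply: cvgD; [exact: cvg_cst|exact: (cvgM SC taul)].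
have tCE : \forall x \near F, t x = C x * (1 + S (C x) / C x * tau x).
  apply: filterS (filterI Cp tauE) => x [/= cp ->].
  by field; rewrite gt_eqF.
have t0 : t @ F --> (0 : R).
  have : (fun x => C x * (1 + S (C x) / C x * tau x)) @ F --> (0 * (1 + 0 * - y0) : R).
    exact: cvgM.
  rewrite mul0r; apply: cvg_trans; apply: near_eq_cvg.
  by apply: filterS tCE => x ->.
have tp : \forall x \near F, 0 < t x.
  have h : \forall x \near F, 0 < 1 + S (C x) / C x * tau x.
    by move/cvgr_gt: tC; apply; rewrite mul0r addr0.
  by apply: filterS (filterI (filterI Cp h) tCE) => x [[/= cp hx] ->]; rewrite mulr_gt0.
have Sp : \forall x \near F, 0 < S (C x).
  by apply: filterS (filterI Cp CD) => x [/= cp cD]; rewrite S_gt0// ltW.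
have tCS : (fun x => (t x - C x) / S (C x)) @ F --> - y0.
  apply: cvg_trans taul; apply: near_eq_cvg.
  apply: filterS (filterI Sp tauE) => x [/= sp ->].
  by rewrite [C x + _]addrC addrK mulrAC divff ?gt_eqF// mul1r.
split=> //.
have SS := cvg_S_ratio t0 C0 tp Cp tCS.
have : (fun x => - ((t x - C x) / S (C x)) / (S (t x) / S (C x))) @ F --> - - y0 / 1.
  apply: cvgM; first exact: cvgN.
  by apply: cvgV => //; exact: oner_neq0.
rewrite opprK divr1; apply: cvg_trans; apply: near_eq_cvg.
have tD : \forall x \near F, t x < D by move/cvgr_lt: t0; apply.
apply: filterS (filterI Sp (filterI tp tD)) => x [/= sp [xp xD]].
have Stp : 0 < S (t x) by rewrite S_gt0// ltW.
by field; rewrite !gt_eqF.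
Qed.

End NearLeaf.

(* [b] tells on which side of [a], right or left, [f] is positive; [r] is an
   affine function of the coordinate [f] close to [a]. *)
Record straight (R : realType) (r s : R -> R) (a : R) (b : bool)
    (k : R) (f g : R -> R) (D d : R) : Prop := Straight {
  straight_kk : k * k = 1;
  straight_fcont : continuous f;
  straight_gcont : continuous g;
  straight_fK : cancel f g;
  straight_gK : cancel g f;
  straight_side : forall x, (0 < f x) = (if b then a < x else x < a);
  straight_between : forall x y t, Num.min x y <= t <= Num.max x y ->
    Num.min (f x) (f y) <= f t <= Num.max (f x) (f y);
  straight_zero : f a = 0;
  straight_D : 0 < D;
  straight_affine : forall x, `|f x| <= D -> f x = k * (r x - r a);
  straight_near : forall x, `|f x| <= D -> `|x - a| < d / 2;
  straight_isolated : forall x, `|x - a| < d -> x != a -> s x != 0;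
  straight_lip : forall e : R, 0 < e -> exists2 d' : R, 0 < d' &
    forall t t', `|t| < d' -> `|t'| < d' -> `|s (g t) - s (g t')| <= e * `|t - t'| }.

(** * A global coordinate adapted to one zero *)

Section Straight.
Variables (R : realType) (r s : R -> R).
Hypothesis rs : tame r s.

Definition clamp (lo hi x : R) : R := Num.max lo (Num.min hi x).

Lemma clamp_id lo hi x : lo <= x <= hi -> clamp lo hi x = x.
Proof. by move=> /andP[lx xh]; rewrite /clamp (min_idPr xh) (max_idPr lx). Qed.

Lemma clamp_continuous lo hi : continuous (clamp lo hi).
Proof.
move=> x; apply: continuous_max; first exact: cst_continuous.
by apply: continuous_min; [exact: cst_continuous|exact: cvg_id].
Qed.

Lemma clamp_itv lo hi x : lo <= hi -> lo <= clamp lo hi x <= hi.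
Proof. by move=> lh; rewrite /clamp le_max lexx/= ge_max lh ge_min lexx. Qed.

Lemma clamp_le lo hi x y : x <= y -> clamp lo hi x <= clamp lo hi y.
Proof.
by move=> xy; rewrite /clamp ge_max !le_max lexx/= le_min !ge_min lexx xy !orbT.
Qed.

Lemma clampB_le lo hi x y : x <= y -> clamp lo hi y - clamp lo hi x <= y - x.
Proof.
move=> xy; rewrite /clamp; case: (leP hi x) => ?; case: (leP hi y) => ?;
  case: (leP lo hi) => ?; case: (leP lo x) => ?; case: (leP lo y) => ?; lra.
Qed.

Lemma straight_right a : s a = 0 -> exists (k : R) (f g : R -> R) (D d : R),
  straight r s a true k f g D d.
Proof.
move=> sa; case: (rs) => cr cs _ _.
have [k [k1 kk kP]] := tame_at rs sa; have [d d0 dP] := tame_isolated rs a.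
have [d1 d10 d1P] := kP 1 ltr01.
pose rho := Num.min d d1 / 4.
have m0 : 0 < Num.min d d1 by rewrite lt_min d0.
have rho0 : 0 < rho by rewrite /rho divr_gt0.
have rhod : rho < d / 2.
  have : Num.min d d1 <= d by rewrite ge_min lexx.
  by rewrite /rho; lra.
have rhod1 : rho < d1.
  have : Num.min d d1 <= d1 by rewrite ge_min lexx orbT.
  by rewrite /rho; lra.
pose cl := clamp (a - rho) (a + rho).
have lh : a - rho <= a + rho by lra.
(* Equal to [k * (r x - r a)] on the window of radius [rho] and continued with slope 1, which makes
   it an increasing homeomorphism of the line without any assumption on [r] far from [a]. *)
pose f x := k * (r (cl x) - r a) + (x - cl x).
have cl_in x : `|cl x - a| < d1.
  by have /andP[? ?] := clamp_itv x lh; rewrite ltr_norml; apply/andP; rewrite /cl; lra.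
have fincr : {homo f : x y / x < y}.
  move=> x y xy; rewrite /f; have c := clamp_le (a - rho) (a + rho) (ltW xy).
  have e : cl y - cl x <= y - x := clampB_le _ _ (ltW xy).
  have [l _ _] := d1P _ _ (cl_in x) (cl_in y).
  have [eq|ne] := eqVneq (cl x) (cl y).
    by rewrite eq ltrD2l ltrD2r.
  have : cl x < cl y by rewrite lt_def eq_sym ne.
  by move=> /l; move: e; rewrite !mulrBr; lra.
have fid x : a - rho <= x <= a + rho -> f x = k * (r x - r a).
  by move=> h; rewrite /f /cl clamp_id// subrr addr0.
have fa : f a = 0 by rewrite fid ?subrr ?mulr0//; apply/andP; lra.
have clc : continuous cl by apply: clamp_continuous.
have cf : continuous f.
  move=> x; apply: cvgD.
    apply: cvgM; first exact: cvg_cst.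
    apply: cvgB; last exact: cvg_cst.
    by apply: cvg_comp; [exact: clc|exact: cr].
  by apply: cvgB; [exact: cvg_id|exact: clc].
have fup M : exists x, M < f x.
  pose x := `|M| + 1 + (a + rho).
  have xr : a + rho <= x by rewrite /x; have := normr_ge0 M; lra.
  exists x; rewrite /f /cl.
  have -> : clamp (a - rho) (a + rho) x = a + rho.
    by rewrite /clamp (min_idPl xr); apply/max_idPr.
  have : 0 < k * (r (a + rho) - r a).
    have [||l _ _] := d1P a (a + rho); last by apply: l; lra.
      by rewrite subrr normr0.
    by rewrite ltr_norml; apply/andP; lra.
  by rewrite /x; have := ler_norm M; lra.
have fdn M : exists x, f x < M.
  pose x := - (`|M| + 1) + (a - rho).
  have xr : x <= a - rho by rewrite /x; have := normr_ge0 M; lra.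
  exists x; rewrite /f /cl.
  have -> : clamp (a - rho) (a + rho) x = a - rho.
    by rewrite /clamp (min_idPr (le_trans xr lh)); apply/max_idPl.
  have : 0 < k * (r a - r (a - rho)).
    have [||l _ _] := d1P (a - rho) a; last by apply: l; lra.
      by rewrite ltr_norml; apply/andP; lra.
    by rewrite subrr normr0.
  by rewrite /x; have := ler_norm (- M); rewrite normrN !mulrBr; lra.
have [g [fK gK cg gincr]] := increasing_unbounded_inverse cf fincr fup fdn.
have fle x y : (f x <= f y) = (x <= y).
  apply/idP/idP; last by rewrite le_eqVlt => /predU1P[->//|/fincr/ltW].
  by apply: contraTT; rewrite -!ltNge => /fincr.
have flt x y : (f x < f y) = (x < y) by rewrite !ltNge fle.
(* The largest bound on [|f x|] that keeps [x] in the window. *)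
pose D := Num.min (f (a + rho)) (- f (a - rho)).
have D0 : 0 < D.
  rewrite /D lt_min oppr_gt0 -{1}fa -fa !flt; apply/andP; lra.
have Dx x : `|f x| <= D -> a - rho <= x <= a + rho.
  by rewrite ler_norml /D lerNl !le_min lerN2 !fle => /andP[/andP[_ ->] /andP[-> _]].
exists k, f, g, D, d; split=> //.
- by move=> x; rewrite -fa flt.
- move=> x y t; rewrite !ge_min !le_max !fle //.
- by move=> x /Dx/fid.
- by move=> x /Dx /andP[? ?]; rewrite ltr_norml; apply/andP; lra.
- move=> e e0; have [d2 d20 d2P] := kP e e0.
  have : g @ 0 --> a by rewrite -[in X in _ --> X](fK a) fa; exact: cg.
  move=> /cvgrPdist_lt /(_ (Num.min d2 rho)); rewrite lt_min d20 => /(_ rho0).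
  move=> /nbhs_ballP[d' /= d'0 d'P]; exists d' => // t t' td td'.
  have near u : `|u| < d' -> `|g u - a| < d2 /\ a - rho <= g u <= a + rho.
    move=> ud; have /d'P : ball (0 : R) d' u by rewrite /ball /= sub0r normrN.
    rewrite /= distrC lt_min => /andP[-> ]; rewrite ltr_norml => /andP[? ?]; split=> //.
    by apply/andP; lra.
  have [n1 n2] := near t td; have [n1' n2'] := near t' td'.
  have [_ l _] := d2P _ _ n1' n1; apply: (le_trans l).
  rewrite -{2}(gK t) -{2}(gK t') !fid//.
  have -> : k * (r (g t) - r a) - k * (r (g t') - r a) = k * (r (g t) - r (g t')) by ring.
  by rewrite normrM k1 mul1r.
Qed.

(** The left side is obtained from the right one by changing the signs of [k] and [f]. The data are
    packed in a tuple for a later use of [choice]. *)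
Lemma straight_exists a b : s a = 0 -> exists w : R * (R -> R) * (R -> R) * R * R,
  let: (k, f, g, D, d) := w in straight r s a b k f g D d.
Proof.
move=> sa; have [k [f [g [D [d st]]]]] := straight_right sa.
case: b; first by exists (k, f, g, D, d).
exists (- k, fun x => - f x, fun x => g (- x), D, d).
case: st => kk cf cg fK gK side btw fa D0 aff near iso lip.
split=> //.
- by rewrite mulrNN.
- by move=> x; apply: cvgN; exact: cf.
- by move=> x; apply: cvg_comp; [exact: opp_continuous|exact: cg].
- by move=> x; rewrite opprK fK.
- by move=> x; rewrite gK opprK.
- move=> x; rewrite oppr_gt0.
  have inj : f x = 0 -> x = a by rewrite -fa => /(can_inj fK).
  have := side x; case: (ltgtP (f x) 0) => [fx|fx|/inj ->]; rewrite ?ltxx//.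
    move=> /esym/negbT; rewrite -leNgt le_eqVlt => /predU1P[xa|-> //].
    by move: fx; rewrite xa fa ltxx.
  by move=> /esym ax; apply/esym/negbTE; rewrite -leNgt ltW.
- move=> x y t /btw; rewrite !ge_min !le_max !lerN2.
  by move=> /andP[/orP[->|->] /orP[->|->]]; rewrite ?orbT.
- by rewrite fa oppr0.
- by move=> x; rewrite normrN => /aff ->; rewrite mulNr.
- by move=> x; rewrite normrN => /near.
- move=> e e0; have [d' d'0 d'P] := lip e e0; exists d' => // t t' td td'.
  apply: (le_trans (d'P _ _ _ _)); rewrite ?normrN//.
  have -> : - t - - t' = t' - t by ring.
  by rewrite distrC.
Qed.

End Straight.

(** * Sliding between levels on one side of a zero *)

Section Slide.
Variables (R : realType) (r s : R -> R).
Hypotheses (cr : continuous r) (cs : continuous s).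
Variables (a : R) (b : bool) (k : R) (f g : R -> R) (D d : R).

(** The number [C] of the charts. The clamp secures [0 <= C] and [4 * C <= D], and sends to 0 all
    levels that do not approach the leaf from this side. Between two levels clamped to the same
    bound the slide is the identity. *)
Definition end_level (c : R) : R := clamp 0 (D / 4) (k * (c - r a)).

(** The function [S] of the charts; [end_sign] restores the sign of [s], which is constant up to
    [D]. *)
Definition end_mag (t : R) : R := `|s (g t)|.

(* Moves the abscissa of a point of the level [c] to that of a point of the level
   [c'], on the side of [a] where [f] is positive. *)
Definition slide (c c' x : R) : R :=
  if 0 < f x then
    g (unchart D (end_level c') (end_mag (end_level c'))
        (chart D (end_level c) (end_mag (end_level c)) (f x)))
  else x.

Hypothesis st : straight r s a b k f g D d.
Hypothesis sa : s a = 0.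
Implicit Types (c x t : R).

Let D0 : 0 < D := straight_D st.
Let fK := straight_fK st.
Let gK := straight_gK st.

Lemma straight_s_neq0 x : f x != 0 -> `|f x| <= D -> s x != 0.
Proof.
move=> fx fD; have n := straight_near st fD; apply: (straight_isolated st).
  by have := normr_ge0 (x - a); lra.
by apply: contra fx => /eqP ->; rewrite (straight_zero st).
Qed.

Lemma straight_strip x y : 0 < f x -> f x <= D -> 0 < f y -> f y <= D -> strip s x y.
Proof.
move=> fx fxD fy fyD t /(straight_between st); rewrite ge_min le_max => ft.
have {ft}ft : 0 < f t <= D by case/andP: ft => /orP[?|?] /orP[?|?]; apply/andP; lra.
case/andP: ft => f0 fD.
by apply: straight_s_neq0; [rewrite gt_eqF|rewrite gtr0_norm].
Qed.

Lemma end_mag_gt0 t : 0 < t -> t <= D -> 0 < end_mag t.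
Proof.
move=> t0 tD; rewrite normr_gt0; apply: straight_s_neq0; rewrite gK ?gt_eqF//.
by rewrite gtr0_norm.
Qed.

Lemma end_mag_continuous : continuous end_mag.
Proof.
move=> t; apply: cvg_norm; apply: cvg_comp; first exact: (straight_gcont st).
exact: cs.
Qed.

Lemma end_mag0 : end_mag 0 = 0.
Proof.
have -> : (0 : R) = f a by rewrite (straight_zero st).
by rewrite /end_mag fK sa normr0 (straight_zero st).
Qed.

Lemma end_mag_lip (e : R) : 0 < e -> exists2 d' : R, 0 < d' &
  forall t t', 0 <= t -> t < d' -> 0 <= t' -> t' < d' ->
    `|end_mag t - end_mag t'| <= e * `|t - t'|.
Proof.
move=> e0; have [d' d'0 dP] := straight_lip st e0; exists d' => // t t' t0 td t0' td'.
by apply: (le_trans (ler_dist_dist _ _)); apply: dP; rewrite ger0_norm.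
Qed.

Lemma end_level_continuous : continuous end_level.
Proof.
move=> c; have h : (fun c => k * (c - r a)) @ c --> k * (c - r a).
  by apply: cvgM; [exact: cvg_cst|apply: cvgB; [exact: cvg_id|exact: cvg_cst]].
by apply: (cvg_comp _ _ h); exact: clamp_continuous.
Qed.

Lemma end_level_ge0 c : 0 <= end_level c.
Proof.
have D4 : 0 <= D / 4 by rewrite divr_ge0 ?ltW.
by have /andP[] := clamp_itv (k * (c - r a)) D4.
Qed.

Lemma end_level_le c : 4 * end_level c <= D.
Proof.
have D4 : 0 <= D / 4 by rewrite divr_ge0 ?ltW.
have /andP[_] := clamp_itv (k * (c - r a)) D4.
by rewrite -/(end_level c) ler_pdivlMr// mulrC.
Qed.

Lemma end_level_gt0 c : (0 < end_level c) = (0 < k * (c - r a)).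
Proof. by rewrite /end_level /clamp lt_max ltxx/= lt_min divr_gt0. Qed.

Lemma end_level_mag c : 0 < end_level c -> 0 < end_mag (end_level c).
Proof.
by move=> c0; apply: end_mag_gt0 => //; move: D0 (end_level_le c) (end_level_ge0 c); lra.
Qed.

Lemma slide_id c c' x : f x <= 0 \/ D <= f x -> slide c c' x = x.
Proof.
rewrite /slide => -[fx|fx]; first by rewrite ltNge fx.
rewrite (lt_le_trans D0 fx) chart_high//; try exact: end_level_ge0; try exact: end_level_le.
rewrite unchart_high//; last first.
  by rewrite lerDl subr_ge0.
by rewrite [2 + _]addrC addrK addrC subrK fK.
Qed.

(** This makes the charts of the two levels have the same range, so that one can be followed by the
    inverse of the other. *)
Definition same_side c c' := (0 < k * (c - r a)) = (0 < k * (c' - r a)).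

Let lvl_ok c t : 0 < t ->
  chart_range (end_level c) (chart D (end_level c) (end_mag (end_level c)) t).
Proof.
by apply: chart_in_range => //; [exact: end_level_ge0|exact: end_level_le|exact: end_level_mag].
Qed.

Let range_same c c' : same_side c c' ->
  chart_range (end_level c) = chart_range (end_level c').
Proof. by rewrite /chart_range !end_level_gt0 => ->. Qed.

Lemma f_slide c c' x : 0 < f x -> f (slide c c' x) =
  unchart D (end_level c') (end_mag (end_level c'))
    (chart D (end_level c) (end_mag (end_level c)) (f x)).
Proof. by rewrite /slide => ->; rewrite gK. Qed.

Lemma slide_gt0 c c' x : same_side c c' -> 0 < f x -> 0 < f (slide c c' x).
Proof.
move=> cc f0; rewrite f_slide//; apply: unchart_gt0 => //.
- exact: end_level_ge0.
- exact: end_level_le.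
- exact: end_level_mag.
- by rewrite -(range_same cc); exact: lvl_ok.
Qed.

Lemma slide_ltD c c' x : same_side c c' -> 0 < f x -> f x < D -> f (slide c c' x) < D.
Proof.
move=> cc f0 fD; rewrite f_slide//; apply: unchart_ltD => //.
- exact: end_level_ge0.
- exact: end_level_le.
- exact: end_level_mag.
- by apply: chart_lt2 => //; [exact: end_level_ge0|exact: end_level_le|exact: end_level_mag].
- by rewrite -(range_same cc); exact: lvl_ok.
Qed.

Lemma slide_strip c c' x : same_side c c' -> 0 < f x -> f x < D ->
  strip s x (slide c c' x).
Proof.
move=> cc f0 fD; apply: straight_strip => //; first exact: ltW.
  exact: slide_gt0.
by apply: ltW; exact: slide_ltD.
Qed.

Lemma slideK c c' x : same_side c c' -> slide c' c (slide c c' x) = x.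
Proof.
move=> cc; have [f0|f0] := ltP 0 (f x); last first.
  by rewrite !slide_id//; left.
rewrite {1}/slide slide_gt0// f_slide// unchartK//.
- rewrite chartK// ?fK//; [exact: end_level_ge0|exact: end_level_le|exact: end_level_mag].
- exact: end_level_ge0.
- exact: end_level_le.
- exact: end_level_mag.
- by rewrite -(range_same cc); exact: lvl_ok.
Qed.

Lemma cvg_slide (T : Type) (F : set_system T) {FF : Filter F} (u v x : T -> R)
    (c c' x0 : R) :
  u @ F --> c -> v @ F --> c' -> x @ F --> x0 -> f x0 != 0 -> same_side c c' ->
  (fun z => slide (u z) (v z) (x z)) @ F --> slide c c' x0.
Proof.
move=> uc vc xx fx0 cc.
have fx : (fun z => f (x z)) @ F --> f x0.
  by apply: (cvg_comp _ _ xx); exact: (straight_fcont st).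
have lc (w : T -> R) (w0 : R) : w @ F --> w0 ->
    (fun z => end_level (w z)) @ F --> end_level w0.
  by move=> ww; apply: (cvg_comp _ _ ww); exact: end_level_continuous.
have mc (w : T -> R) (w0 : R) : w @ F --> w0 ->
    (fun z => end_mag (end_level (w z))) @ F --> end_mag (end_level w0).
  by move=> /lc ww; apply: (cvg_comp _ _ ww); exact: end_mag_continuous.
move: fx0; rewrite neq_lt => /orP[f0|f0].
  rewrite (slide_id _ _ (or_introl (ltW f0))); apply: cvg_trans xx; apply: near_eq_cvg.
  have h : \forall z \near F, f (x z) < 0 by move/cvgr_lt: fx; apply.
  by apply: filterS h => z /= h; rewrite slide_id//; left; exact: ltW.
have h : \forall z \near F, 0 < f (x z) by move/cvgr_gt: fx; apply.
have main : (fun z => g (unchart D (end_level (v z)) (end_mag (end_level (v z)))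
    (chart D (end_level (u z)) (end_mag (end_level (u z))) (f (x z))))) @ F -->
    slide c c' x0.
  rewrite /slide f0; apply: (@cvg_comp _ _ _ _ g _ (nbhs (_ : R))); last exact: (straight_gcont st).
  apply: cvg_unchart => //.
  - exact: end_level_ge0.
  - exact: end_level_le.
  - exact: end_level_mag.
  - exact: lc.
  - exact: mc.
  - by rewrite -(range_same cc); exact: lvl_ok.
  apply: cvg_chart => //.
  - exact: end_level_ge0.
  - exact: end_level_le.
  - exact: end_level_mag.
  - exact: lc.
  - exact: mc.
apply: cvg_trans main; apply: near_eq_cvg.
by apply: filterS h => z /= h; rewrite /slide h.
Qed.

End Slide.

Section SlideLeaf.
Variables (R : realType) (r s : R -> R).
Hypotheses (cr : continuous r) (cs : continuous s).
Variables (a : R) (b : bool) (k : R) (f g : R -> R) (D d : R).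
Hypothesis st : straight r s a b k f g D d.
Hypothesis sa : s a = 0.

Lemma end_sign : exists2 e : R, e * e = 1 &
  forall t, 0 < t -> t <= D -> s (g t) = e * end_mag s g t.
Proof.
have D0 := straight_D st.
have sg0 t : 0 < t -> t <= D -> s (g t) != 0.
  by move=> t0 tD; rewrite -normr_gt0; exact: (end_mag_gt0 st).
have nz : Num.sg (s (g D)) * Num.sg (s (g D)) = 1.
  by rewrite -expr2 sqr_sg sg0.
exists (Num.sg (s (g D))) => // t t0 tD.
suff -> : Num.sg (s (g D)) = Num.sg (s (g t)) by rewrite /end_mag mulr_sg_norm.
have cg : continuous (s \o g).
  by move=> u; apply: cvg_comp; [exact: (straight_gcont st)|exact: cs].
have zero u v : 0 < u -> u <= D -> 0 < v -> v <= D -> s (g u) < 0 -> 0 < s (g v) -> False.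
  move=> u0 uD v0 vD su sv.
  have [|t' ht' /=] := @IVT_setT R (s \o g) u v 0 cg; first by rewrite /= !ltW.
  apply/eqP/sg0; move: ht'; rewrite ge_min le_max => /andP[/orP[?|?] /orP[?|?]]; lra.
have := sg0 _ D0 (lexx _); have := sg0 _ t0 tD; rewrite !neq_lt.
move=> /orP[st'|st'] /orP[sD|sD]; rewrite ?(ltr0_sg st') ?(gtr0_sg st') ?(ltr0_sg sD) ?(gtr0_sg sD)//.
  by case: (zero t D).
by case: (zero D t).
Qed.

Variables (T : Type) (F : set_system T).
Context {FF : Filter F}.

(** The chart value of [z] has a limit that depends on [y0] alone, and reading this value on the
    level [c'] gives back the limiting ordinate [y0]. Of [c'] only its limit [r a] and its side
    matter, not its rate of convergence. *)
Lemma cvg_slide_leaf (z : T -> R * R) (c' : T -> R) (y0 : R) :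
  (fun i => (z i).1) @ F --> a -> (fun i => (z i).2) @ F --> y0 ->
  (\forall i \near F, 0 < f (z i).1) -> c' @ F --> r a ->
  (\forall i \near F, same_side r a k (lin r s (z i)) (c' i)) ->
  let x' i := slide r s a k f g D (lin r s (z i)) (c' i) (z i).1 in
  x' @ F --> a /\ (fun i => lvl r s (c' i) (x' i)) @ F --> y0.
Proof.
move=> z1 z2 fp cc' side x'.
have [e ee eP] := end_sign; have D0 := straight_D st; have kk := straight_kk st.
have gc := straight_gcont st; have fa := straight_zero st.
have Sg t : 0 < t -> t <= D -> 0 < end_mag s g t by move=> ? ?; exact: (end_mag_gt0 st).
pose t i := f (z i).1.
pose C i := k * (lin r s (z i) - r a).
pose C' i := k * (c' i - r a).
have t0 : t @ F --> (0 : R) by rewrite -fa; apply: (cvg_comp _ _ z1); exact: (straight_fcont st).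
have tD : \forall i \near F, t i < D by move/cvgr_lt: t0; apply.
(* Since [k] and [e] are signs, the ordinate used by the charts is the true one multiplied by the
   sign [k * e], which is cancelled at the end. *)
have yl : (fun i => (C i - t i) / end_mag s g (t i)) @ F --> k * e * y0.
  have : (fun i => k * e * (z i).2) @ F --> k * e * y0.
    by apply: cvgM => //; exact: cvg_cst.
  apply: cvg_trans; apply: near_eq_cvg.
  apply: filterS (filterI fp tD) => i [/= fi tDi].
  have Si := Sg _ fi (ltW tDi); have Sn : end_mag s g (t i) != 0 by rewrite gt_eqF.
  apply: (mulIf Sn); rewrite divfK//.
  have tE : t i = k * (r (z i).1 - r a).
    by apply: (straight_affine st); rewrite gtr0_norm// ltW.
  have := eP _ fi (ltW tDi); rewrite (straight_fK st) -/(t i) => sz.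
  by rewrite /C /lin sz [X in _ = _ - X]tE; ring.
have [C0 Cp chl] := @cvg_chart_near R (end_mag s g) D D0 (end_mag0 st sa) Sg
  (end_mag_lip st) T F FF t C (k * e * y0) t0 fp yl.
have C'0 : C' @ F --> (0 : R).
  have : C' @ F --> k * (r a - r a).
    by apply: cvgM; [exact: cvg_cst|apply: cvgB => //; exact: cvg_cst].
  by rewrite subrr mulr0.
have C'p : \forall i \near F, 0 < C' i.
  by apply: filterS (filterI side Cp) => i [/= h]; rewrite /C /C' -h.
have [] := @cvg_unchart_near R (end_mag s g) D D0 (end_mag0 st sa) Sg
  (end_mag_lip st) T F FF _ C' (k * e * y0) C'0 C'p chl.
set t' := (X in X @ F --> (0 : R)) => t'0 t'p yl'.
have D4 : 0 < D / 4 by rewrite divr_gt0.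
have CD : \forall i \near F, C i < D / 4 by move/cvgr_lt: C0; apply.
have C'D : \forall i \near F, C' i < D / 4 by move/cvgr_lt: C'0; apply.
have x'E : \forall i \near F, x' i = g (t' i).
  apply: filterS (filterI (filterI fp (filterI Cp CD)) (filterI C'p C'D)).
  move=> i [[/= fi [ci ciD]] [ci' ciD']]; rewrite /x' /slide fi.
  by rewrite /end_level !clamp_id// ?(ltW ci) ?(ltW ci') ltW.
have ga : g 0 = a by rewrite -fa (straight_fK st).
have t'D : \forall i \near F, t' i < D by move/cvgr_lt: t'0; apply.
split.
  have : (fun i => g (t' i)) @ F --> g 0 by apply: (cvg_comp _ _ t'0); exact: gc.
  rewrite ga; apply: cvg_trans; apply: near_eq_cvg.
  by apply: filterS x'E => i /= ->.
have : (fun i => k * e * ((C' i - t' i) / end_mag s g (t' i))) @ F --> k * e * (k * e * y0).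
  by apply: cvgM => //; exact: cvg_cst.
have -> : k * e * (k * e * y0) = y0.
  have -> : k * e * (k * e * y0) = (k * k) * (e * e) * y0 by ring.
  by rewrite kk ee !mul1r.
apply: cvg_trans; apply: near_eq_cvg.
apply: filterS (filterI x'E (filterI t'p t'D)) => i [/= xi [ti tDi]].
rewrite /lvl xi.
have Si := Sg _ ti (ltW tDi); have Sn : end_mag s g (t' i) != 0 by rewrite gt_eqF.
have en : e != 0 by apply/eqP => e0; move: ee; rewrite e0 mul0r => /esym/eqP; rewrite oner_eq0.
rewrite (eP _ ti (ltW tDi)).
have aff : t' i = k * (r (g (t' i)) - r a).
  rewrite -[LHS](straight_gK st); apply: (straight_affine st).
  by rewrite (straight_gK st) gtr0_norm// ltW.
apply: (mulIf (mulf_neq0 en Sn)); rewrite divfK ?mulf_neq0//.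
have -> : k * e * ((C' i - t' i) / end_mag s g (t' i)) * (e * end_mag s g (t' i)) =
  e * e * (k * (C' i - t' i)) by field.
rewrite ee mul1r [X in _ - X]aff /C'.
have -> : k * (k * (c' i - r a) - k * (r (g (t' i)) - r a)) =
  k * k * (c' i - r (g (t' i))) by ring.
by rewrite kk mul1r.
Qed.

End SlideLeaf.

(** [U x] is the map of the values over the strip of [x]. Nothing is required when [s x = 0]. *)
Definition level_change (R : realType) (r s : R -> R) (U : R -> R -> R) : Prop :=
  [/\ forall x x', strip s x x' -> U x = U x',
      forall x, s x != 0 -> continuous (U x),
      forall x, s x != 0 -> {homo U x : c c' / c < c'} &
      forall x a, s x != 0 -> s a = 0 -> U x (r a) = r a].

Lemma level_change_side (R : realType) (r s : R -> R) (U : R -> R -> R) (a x c k : R) :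
  level_change r s U -> s x != 0 -> s a = 0 -> same_side r a k c (U x c).
Proof.
move=> [_ _ mono fix_] sx sa; rewrite /same_side.
have fa := fix_ x a sx sa; have m := mono x sx.
have [ca|ac|->] := ltgtP c (r a); last by rewrite fa.
- have := m _ _ ca; rewrite fa => ca'.
  by rewrite !nmulr_lgt0 ?subr_lt0.
- have := m _ _ ac; rewrite fa => ca'.
  by rewrite !pmulr_lgt0 ?subr_gt0.
Qed.

(** * Assembling the slides into a homeomorphism of the plane *)

Section LevelChange.
Variables (R : realType) (r s : R -> R).
Hypothesis rs : tame r s.
Variables (k : R * bool -> R) (f g : R * bool -> R -> R) (D d : R * bool -> R).
Hypothesis st : forall i, s i.1 = 0 -> straight r s i.1 i.2 (k i) (f i) (g i) (D i) (d i).
Variable ends : seq (R * bool).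
Hypotheses (ends_uniq : uniq ends) (endsP : forall i, (i \in ends) = (s i.1 == 0)).

Let sl i c c' x := slide r s i.1 (k i) (f i) (g i) (D i) c c' x.
Let cr : continuous r. Proof. by case: rs. Qed.
Let cs : continuous s. Proof. by case: rs. Qed.

(** At most one term is nonzero, because the windows of the pairs zero and side in [ends] are
    disjoint. Writing a sum instead of a case distinction makes continuity immediate. *)
Definition shift_abscissa (c c' x : R) : R := x + \sum_(i <- ends) (sl i c c' x - x).

(** A window lies within half of the isolation radius [d] of its zero, so that windows of two
    distinct zeros cannot meet. The two windows of one zero lie on opposite sides of it. *)
Lemma ends_disjoint i j x : i \in ends -> j \in ends ->
  0 < f i x -> f i x < D i -> 0 < f j x -> f j x < D j -> i = j.
Proof.
have aux (A B C p q : R) : B < p / 2 -> C < q / 2 -> p <= A -> q <= A -> A <= B + C -> False.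
  by lra.
rewrite !endsP => /eqP si /eqP sj fi fiD fj fjD.
have sti := st si; have stj := st sj.
have ni : `|x - i.1| < d i / 2 by apply: (straight_near sti); rewrite gtr0_norm// ltW.
have nj : `|x - j.1| < d j / 2 by apply: (straight_near stj); rewrite gtr0_norm// ltW.
have [e|ne] := eqVneq i.1 j.1.
  move: fi fj; rewrite (straight_side sti) (straight_side stj) e.
  case: i j {ni nj sti stj fiD fjD si sj} e => [a b] [a' b'] /= <-.
  by case: b; case: b' => // h1 h2; have := lt_trans h1 h2; rewrite ltxx.
have di : d i <= `|i.1 - j.1|.
  rewrite leNgt; apply/negP => h.
  have := straight_isolated sti (x := j.1); rewrite distrC h eq_sym ne => /(_ isT isT).
  by rewrite sj eqxx.
have dj : d j <= `|i.1 - j.1|.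
  rewrite leNgt; apply/negP => h.
  have := straight_isolated stj (x := i.1); rewrite h ne => /(_ isT isT).
  by rewrite si eqxx.
case: (aux _ _ _ _ _ ni nj di dj).
by rewrite [`|x - i.1|]distrC; have := ler_normD (i.1 - x) (x - j.1); rewrite addrA subrK.
Qed.

Lemma shift_abscissa_in i c c' x : i \in ends -> 0 < f i x -> f i x < D i ->
  shift_abscissa c c' x = sl i c c' x.
Proof.
move=> iin fi fiD; rewrite /shift_abscissa (bigD1_seq i)//= big1_seq.
  by rewrite addr0 addrC subrK.
move=> j /andP[ji jin]; rewrite /sl (slide_id (st _)) ?subrr//; first by apply/eqP; rewrite -endsP.
have [fj|fj] := leP (f j x) 0; [by left|right; rewrite leNgt; apply/negP => fjD].
by move: ji; rewrite (ends_disjoint iin jin fi fiD fj fjD) eqxx.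
Qed.

Lemma shift_abscissa_out c c' x :
  (forall i, i \in ends -> f i x <= 0 \/ D i <= f i x) -> shift_abscissa c c' x = x.
Proof.
move=> out; rewrite /shift_abscissa big1_seq ?addr0// => i /andP[_ iin].
by rewrite /sl (slide_id (st _)) ?subrr//; [apply/eqP; rewrite -endsP|exact: out].
Qed.

Lemma ends_cases x : (exists i, [/\ i \in ends, 0 < f i x & f i x < D i]) \/
  (forall i, i \in ends -> f i x <= 0 \/ D i <= f i x).
Proof.
have [|out] := pselect (exists i, [/\ i \in ends, 0 < f i x & f i x < D i]); first by left.
right=> i iin; have [?|fi] := leP (f i x) 0; [by left|right; rewrite leNgt; apply/negP => fiD].
by apply: out; exists i.
Qed.

Let side c c' := forall i, i \in ends -> same_side r i.1 (k i) c c'.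

Lemma shift_abscissa_strip c c' x : s x != 0 -> side c c' ->
  strip s x (shift_abscissa c c' x).
Proof.
move=> sx cc; have [[i [iin fi fiD]]|out] := ends_cases x; last first.
  by rewrite shift_abscissa_out//; exact: strip_refl.
rewrite (shift_abscissa_in _ _ iin fi fiD).
by apply: (slide_strip (st _)) => //; [apply/eqP; rewrite -endsP|exact: cc].
Qed.

Lemma shift_abscissaK c c' x : side c c' ->
  shift_abscissa c' c (shift_abscissa c c' x) = x.
Proof.
move=> cc; have [[i [iin fi fiD]]|out] := ends_cases x; last first.
  by rewrite [shift_abscissa c c' x]shift_abscissa_out ?shift_abscissa_out.
have sti := st (elimT eqP (etrans (esym (endsP i)) iin)).
have cci := cc _ iin.
rewrite [shift_abscissa c c' x](shift_abscissa_in _ _ iin fi fiD).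
rewrite (shift_abscissa_in _ _ iin).
- exact: (slideK sti).
- exact: (slide_gt0 sti).
- exact: (slide_ltD sti).
Qed.

Lemma cvg_shift_abscissa (T : Type) (F : set_system T) {FF : Filter F} (u v x : T -> R)
    (c c' x0 : R) :
  u @ F --> c -> v @ F --> c' -> x @ F --> x0 -> s x0 != 0 -> side c c' ->
  (fun z => shift_abscissa (u z) (v z) (x z)) @ F --> shift_abscissa c c' x0.
Proof.
move=> uc vc xx sx0 cc; rewrite /shift_abscissa; apply: cvgD => //.
have H i : i \in ends -> (fun z => sl i (u z) (v z) (x z) - x z) @ F --> sl i c c' x0 - x0.
  move=> iin; have si : s i.1 = 0 by apply/eqP; rewrite -endsP.
  apply: cvgB => //; apply: (cvg_slide cs (st si)) => //; last exact: cc.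
  apply: contra sx0 => /eqP fx0.
  have : x0 = i.1 by apply: (can_inj (straight_fK (st si))); rewrite fx0 (straight_zero (st si)).
  by move=> ->; rewrite si.
elim: ends H => [|i l IH] H.
  under eq_fun do rewrite big_nil.
  by rewrite big_nil; exact: cvg_cst.
under eq_fun do rewrite big_cons.
rewrite big_cons; apply: cvgD; first by apply: H; rewrite mem_head.
by apply: IH => j jl; apply: H; rewrite inE jl orbT.
Qed.

(** The map [K] of the overview: the new level is prescribed, the new abscissa is the shifted one,
    and the ordinate follows. The inverse is the same construction for the inverse maps of
    values. *)
Definition change (U : R -> R -> R) (z : R * R) : R * R :=
  if s z.1 == 0 then z else
  let c' := U z.1 (lin r s z) in
  let x' := shift_abscissa (lin r s z) c' z.1 in (x', lvl r s c' x').

Lemma change_zero U z : s z.1 = 0 -> change U z = z.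
Proof. by rewrite /change => ->; rewrite eqxx. Qed.

Section Change.
Variable U : R -> R -> R.
Hypothesis Uch : level_change r s U.

Let sideU x c : s x != 0 -> side c (U x c).
Proof. by move=> sx i; rewrite endsP => /eqP si; exact: level_change_side Uch sx si. Qed.

Lemma change_strip z : s z.1 != 0 -> strip s z.1 (change U z).1.
Proof.
move=> sz; rewrite /change (negbTE sz) /=.
by apply: shift_abscissa_strip => //; exact: sideU.
Qed.

Lemma lin_change z : s z.1 != 0 -> lin r s (change U z) = U z.1 (lin r s z).
Proof.
move=> sz; have := stripr (change_strip sz); rewrite /change (negbTE sz) /= => sz'.
by rewrite lin_lvl.
Qed.

Lemma changeK V : level_change r s V ->
  (forall x, s x != 0 -> cancel (U x) (V x)) -> cancel (change U) (change V).
Proof.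
move=> [Vst _ _ _] UV z; have [sz|sz] := eqVneq (s z.1) 0; first by rewrite !change_zero.
have zs := change_strip sz; have sz' := stripr zs.
rewrite {1}/change (negbTE sz') lin_change//= -(Vst _ _ zs) UV//.
have -> : (change U z).1 = shift_abscissa (lin r s z) (U z.1 (lin r s z)) z.1.
  by rewrite /change (negbTE sz).
rewrite shift_abscissaK; last exact: sideU.
by rewrite lvl_lin//; case: z {sz zs sz'}.
Qed.

Lemma change_continuous_strip z0 : s z0.1 != 0 -> {for z0, continuous (change U)}.
Proof.
move=> sz0; have [d0 d00 d0P] := tame_strip_near rs sz0.
have nst : \forall z \near z0, strip s z.1 z0.1.
  have h : \forall z \near z0, `|z.1 - z0.1| < d0.
    have : (fun z : R * R => `|z.1 - z0.1|) @ z0 --> `|z0.1 - z0.1|.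
      by apply: cvg_norm; apply: cvgB; [exact: cvg_fst|exact: cvg_cst].
    by move/cvgr_lt; apply; rewrite subrr normr0.
  by apply: filterS h => z /= zd; apply: d0P => //; rewrite subrr normr0.
have [Ust Uc _ _] := Uch.
(* [U z.1] is frozen at [U z0.1], which agrees with it nearby and is a single continuous
   function. *)
pose G z := let x' := shift_abscissa (lin r s z) (U z0.1 (lin r s z)) z.1 in
  (x', lvl r s (U z0.1 (lin r s z)) x').
have E : \forall z \near z0, G z = change U z.
  by apply: filterS nst => z h; rewrite /G /change (negbTE (stripl h)) (Ust _ _ h).
have GE0 : G z0 = change U z0 by rewrite /G /change (negbTE sz0).
rewrite /prop_for /continuous_at -GE0.
have lc : lin r s @ z0 --> lin r s z0 by exact: lin_continuous.
have Ulc : (fun z => U z0.1 (lin r s z)) @ z0 --> U z0.1 (lin r s z0).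
  by apply: (cvg_comp _ _ lc); exact: Uc.
have xc : (fun z => shift_abscissa (lin r s z) (U z0.1 (lin r s z)) z.1) @ z0 -->
    shift_abscissa (lin r s z0) (U z0.1 (lin r s z0)) z0.1.
  by apply: cvg_shift_abscissa => //; [exact: cvg_fst|exact: sideU].
have Gc : G @ z0 --> G z0.
  apply: cvg_pairR => //; apply: cvg_lvl => //.
  by have := stripr (change_strip sz0); rewrite /change (negbTE sz0).
by apply: cvg_trans Gc; apply: near_eq_cvg.
Qed.

Lemma change_continuous_leaf z0 : s z0.1 = 0 -> {for z0, continuous (change U)}.
Proof.
case: z0 => a y0 /= sa; have [Ust Uc _ Ufix] := Uch.
rewrite /prop_for /continuous_at change_zero//.
have oneside b : change U @ within [set z : R * R | 0 < f (a, b) z.1] (nbhs (a, y0)) --> (a, y0).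
  set F := within _ _; have FF : Filter F by exact: within_filter.
  have st' := st (i := (a, b)) sa; have iin : (a, b) \in ends by rewrite endsP /= sa.
  have D0 := straight_D st'.
  have f1 : (fun z : R * R => z.1) @ F --> a by apply: cvg_within_filter; exact: cvg_fst.
  have f2 : (fun z : R * R => z.2) @ F --> y0 by apply: cvg_within_filter; exact: cvg_snd.
  have fp : \forall z \near F, 0 < f (a, b) z.1.
    by rewrite /F; apply: withinT; exact: nbhs_filter.
  have flim : (fun z : R * R => f (a, b) z.1) @ F --> (0 : R).
    rewrite -(straight_zero st'); apply: (cvg_comp _ _ f1); exact: (straight_fcont st').
  have fD : \forall z \near F, f (a, b) z.1 < D (a, b) by move/cvgr_lt: flim; apply.
  (* A reference abscissa in the strip adjacent to the leaf on the side [b]: there [U z.1] is the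
     fixed function [U x1], and [c'] tends to [r a] because [U x1] fixes this value. *)
  pose x1 := g (a, b) (D (a, b)).
  have fx1 : f (a, b) x1 = D (a, b) by rewrite (straight_gK st').
  have sx1 : s x1 != 0.
    by apply: (straight_s_neq0 st'); rewrite fx1 ?gt_eqF// gtr0_norm.
  have stz (z : R * R) : 0 < f (a, b) z.1 -> f (a, b) z.1 < D (a, b) -> strip s z.1 x1.
    by move=> h1 h2; apply: (straight_strip st') => //; rewrite ?fx1// ltW.
  pose c' z := U x1 (lin r s z).
  have c'l : c' @ F --> r a.
    rewrite -(Ufix x1 a sx1 sa); apply: (@cvg_comp _ _ _ (lin r s) (U x1) _ (nbhs (r a))); last exact: Uc.
    rewrite -(@lin_zero R r s (a, y0)) //.
    by apply: cvg_within_filter; exact: lin_continuous.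
  have sd : \forall z \near F, same_side r a (k (a, b)) (lin r s z) (c' z).
    by apply: nearW => z; exact: level_change_side Uch sx1 sa.
  have [] := @cvg_slide_leaf R r s cs a b _ _ _ _ _ st' sa _ F FF id c' y0 f1 f2 fp c'l sd.
  set x' := (X in X @ F --> a) => x'l y'l.
  have : (fun z => (x' z, lvl r s (c' z) (x' z))) @ F --> (a, y0) by exact: cvg_pairR.
  apply: cvg_trans; apply: near_eq_cvg.
  apply: filterS (filterI fp fD) => z [/= h1 h2].
  have zst := stz z h1 h2.
  rewrite /change (negbTE (stripl zst)) (Ust _ _ zst) -/(c' z).
  by rewrite (shift_abscissa_in _ _ iin h1 h2).
move=> N N0.
have r1 := oneside true N N0; have r2 := oneside false N N0.
rewrite /= /nbhs /= in r1 r2.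
suff : \forall z \near (a, y0), N (change U z) by [].
have n1 : \forall z \near (a, y0), 0 < f (a, true) z.1 -> N (change U z) by exact: r1.
have n2 : \forall z \near (a, y0), 0 < f (a, false) z.1 -> N (change U z) by exact: r2.
apply: filterS (filterI N0 (filterI n1 n2)) => z [Nz [h1 h2]].
move: h1 h2; rewrite (straight_side (st (i := (a, true)) sa)) (straight_side (st (i := (a, false)) sa)) /=.
have [za|za|za] := ltgtP z.1 a; [by move=> _; apply|by move=> + _; apply|move=> _ _].
by rewrite change_zero// za.
Qed.

Lemma change_continuous : continuous (change U).
Proof.
move=> z; have [sz|sz] := eqVneq (s z.1) 0; first exact: change_continuous_leaf.
exact: change_continuous_strip.
Qed.

End Change.
End LevelChange.

Lemma level_change_homeomorphism (R : realType) (r s : R -> R) (U V : R -> R -> R) :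
  tame r s -> level_change r s U -> level_change r s V ->
  (forall x, s x != 0 -> cancel (U x) (V x)) ->
  (forall x, s x != 0 -> cancel (V x) (U x)) ->
  exists K : R * R -> R * R, [/\ homeomorphism K, forall z, s z.1 = 0 -> K z = z,
    forall z, s z.1 != 0 -> strip s z.1 (K z).1 &
    forall z, s z.1 != 0 -> lin r s (K z) = U z.1 (lin r s z)].
Proof.
move=> rs Uch Vch UV VU.
(* Away from the zeros of [s] an arbitrary tuple makes the choice total. *)
have PW (i : R * bool) : exists w : R * (R -> R) * (R -> R) * R * R, s i.1 = 0 ->
    let: (k, f, g, D, d) := w in straight r s i.1 i.2 k f g D d.
  have [si|si] := eqVneq (s i.1) 0.
    by have [w wP] := straight_exists rs i.2 si; exists w.
  by exists (0, id, id, 0, 0) => si'; move: si; rewrite si' eqxx.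
have [W WP] := choice PW.
pose k i := (W i).1.1.1.1; pose f i := (W i).1.1.1.2; pose g i := (W i).1.1.2.
pose D i := (W i).1.2; pose d i := (W i).2.
have st i : s i.1 = 0 -> straight r s i.1 i.2 (k i) (f i) (g i) (D i) (d i).
  by move=> /WP; rewrite /k /f /g /D /d; case: (W i) => [[[[? ?] ?] ?] ?].
have [ends eu eP] : exists2 ends : seq (R * bool), uniq ends &
    forall i, (i \in ends) = (s i.1 == 0).
  case: rs => _ _ fin _; have /finite_seqP[l lE] := fin.
  exists [seq (a, b) | a <- undup l, b <- [:: true; false]].
    by apply: allpairs_uniq => //; [exact: undup_uniq|move=> [? ?] [? ?] _ _ ].
  move=> [a b]; have al : (a \in undup l) = (s a == 0).
    rewrite mem_undup; apply/idP/eqP => h.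
      by have : [set` l] a by []; rewrite -lE.
    by have : [set x | s x = 0] a by []; rewrite lE.
  rewrite -[RHS]al; apply/idP/idP => [/allpairsPdep[a' [b' [h _ [-> _]]]] //|h].
  by apply/allpairsPdep; exists a, b; split=> //; case: b.
exists (change r s k f g D ends U); split.
- exists (change r s k f g D ends V); split.
  + exact: (changeK st eu eP Uch Vch UV).
  + exact: (changeK st eu eP Vch Uch VU).
  + exact: (change_continuous rs st eu eP Uch).
  + exact: (change_continuous rs st eu eP Vch).
- by move=> z; exact: change_zero.
- by move=> z; exact: (change_strip st eu eP Uch).
- by move=> z; exact: (lin_change st eu eP Uch).
Qed.

(** * The maps induced on the values *)

(** Connectedness of the line: the function equal to 1 on [P] and to -1 off it is continuous and
    does not vanish. *)
Lemma locally_constant_constant (R : realType) (P : R -> Prop) :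
  (forall x0, exists2 d : R, 0 < d & forall x y, `|x - x0| < d -> `|y - x0| < d -> P x -> P y) ->
  forall x y, P x -> P y.
Proof.
move=> loc x y Px; apply: contrapT => Py.
pose e t : R := if `[< P t >] then 1 else -1.
have ce : continuous e.
  move=> t; have [d d0 dP] := loc t.
  suff E : \forall u \near t, e t = e u.
    have : (fun=> e t) @ t --> e t by exact: cvg_cst.
    by apply: cvg_trans; apply: near_eq_cvg; apply: filterS E.
  apply/nbhs_ballP; exists d => //= u; rewrite /ball /= distrC => ud.
  have td : `|t - t| < d by rewrite subrr normr0.
  rewrite /e; congr (if _ then _ else _).
  by apply/asboolP/asboolP; exact: dP.
have [|t _] := @IVT_setT R e y x 0 ce.
  by rewrite /e (asboolT Px) (asboolF Py) lerN10 ler01.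
by rewrite /e; case: ifP => _ /eqP; rewrite ?oppr_eq0 oner_eq0.
Qed.

Lemma finite_set_upper_bound (R : realType) (A : set R) : finite_set A ->
  exists M, forall x, A x -> x < M.
Proof.
move=> /finite_seqP[l ->]; elim: l => [|a l [M MP]]; first by exists 0.
exists (Num.max M (a + 1)) => x; rewrite /= inE lt_max => /predU1P[->|/MP ->//].
by rewrite ltrDl ltr01 orbT.
Qed.

(** The map [g_i] of the overview for the strip of [x], read on the transversal over [x]; a junk
    value if [s x = 0]. *)
Definition holonomy (R : realType) (r s r' s' : R -> R) (h : R * R -> R * R) (x c : R) : R :=
  lin r' s' (h (x, lvl r s c x)).

(* The leaves through the transversal [{x} * R] leave every vertical leaf of
   the image, so that from some level on their images stay in one strip.  If
   their values had a supremum, the leaf with this value in that strip would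
   have to be the image of a leaf of infinite level. *)
Lemma holonomy_unbounded (R : realType) (r s r' s' : R -> R) (h h' : R * R -> R * R) (x : R) :
  continuous r -> continuous s -> continuous r' -> continuous s' ->
  finite_set [set t | s' t = 0] -> continuous h -> continuous h' -> cancel h h' ->
  (forall w w', same_leaf r' s' w w' -> lin r s (h' w) = lin r s (h' w')) ->
  s x != 0 -> {homo holonomy r s r' s' h x : c c' / c < c'} ->
  forall M, exists c, M < holonomy r s r' s' h x c.
Proof.
move=> cr cs cr' cs' fin ch ch' hK leaf sx incr M.
apply: contrapT => /forallNP bnd; set G := holonomy r s r' s' h x in incr bnd.
pose w c := h (x, lvl r s c x).
have h'w c : lin r s (h' (w c)) = c by rewrite /w hK lin_lvl.
have cw : continuous (fun c => (w c).1).
  move=> c; apply: (@cvg_comp _ _ _ w fst _ (nbhs (w c))); last exact: cvg_fst.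
  have lc : (fun c => (x, lvl r s c x)) @ c --> (x, lvl r s c x).
    by apply: cvg_pairR; [exact: cvg_cst|apply: cvg_lvl => //; exact: cvg_cst].
  by apply: (cvg_comp _ _ lc); exact: ch.
(* The curve [w] meets a vertical leaf at most once, because [h'] sends each leaf into one level and
   [w c] comes from the level [c]. *)
have : finite_set ((fun c => (w c).1) @^-1` [set t | s' t = 0]).
  apply: finite_preimage => // c c'; rewrite !inE /= => z z' e.
  by rewrite -(h'w c) -(h'w c'); apply: leaf; split; [rewrite !lin_zero// e|right].
move=> /finite_set_upper_bound[c0 c0P].
have nz c : c0 <= c -> s' (w c).1 != 0.
  by move=> cc; apply/eqP => z; have := c0P c z; rewrite ltNge cc.
have st c : c0 <= c -> strip s' (w c0).1 (w c).1.
  move=> cc; apply: contrapT => /not_strip[t tt st].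
  have [c2] : exists2 c2, c0 <= c2 & (w c2).1 = t.
    have cc' : Num.min c c0 = c0 /\ Num.min c0 c = c0.
      by split; [exact/min_idPr|exact/min_idPl].
    have [l|l] := leP (w c0).1 (w c).1.
      move: tt; rewrite (min_idPl l) (max_idPr l) => tt.
      by have [c2 + e] := IVT_setT cw tt; rewrite cc'.2 => /andP[? _]; exists c2.
    move: tt; rewrite (min_idPr (ltW l)) (max_idPl (ltW l)) => tt.
    by have [c2 + e] := IVT_setT cw tt; rewrite cc'.1 => /andP[? _]; exists c2.
  by move=> /nz + e; rewrite e st eqxx.
have sx' := nz c0 (lexx _); set x' := (w c0).1 in sx' st.
(* The transport back along the transversal over [x']. It inverts [G] beyond [c0] and is continuous
   at the supremum [L], whereas [gam (G c) = c] grows without bound as [G c] approaches [L]. *)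
pose gam u := lin r s (h' (x', lvl r' s' u x')).
have cgam : continuous gam.
  move=> u; have lc : (fun c => (x', lvl r' s' c x')) @ u --> (x', lvl r' s' u x').
    by apply: cvg_pairR; [exact: cvg_cst|apply: cvg_lvl => //; exact: cvg_cst].
  have hc : (fun c => h' (x', lvl r' s' c x')) @ u --> h' (x', lvl r' s' u x').
    by apply: (cvg_comp _ _ lc); exact: ch'.
  by apply: (cvg_comp _ _ hc); exact: lin_continuous.
have gamG c : c0 <= c -> gam (G c) = c.
  move=> cc; rewrite -[RHS](h'w c); apply: leaf; split; first by rewrite lin_lvl.
  by left; exact: st.
have supA : has_sup (range G).
  split; first by exists (G 0), 0.
  by exists M => _ [c _ <-]; rewrite leNgt; apply/negP; exact: bnd.
pose L := sup (range G).
have := cgam L; move=> /cvgrPdist_lt /(_ 1 ltr01) /nbhs_ballP[d /= d0 dP].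
have [_ [c1 _ <-] c1P] := sup_adherent d0 supA.
pose c := Num.max c1 (Num.max c0 (gam L + 1)).
have c1c : c1 <= c by rewrite le_max lexx.
have c0c : c0 <= c by rewrite !le_max lexx orbT.
have glc : gam L + 1 <= c by rewrite !le_max lexx !orbT.
have GL : G c <= L by apply: sup_ubound; [exact: supA.2|exists c].
have Gc : G c1 <= G c by move: c1c; rewrite le_eqVlt => /predU1P[->//|/incr/ltW].
have : ball L d (G c).
  by rewrite /ball /= ltr_norml; apply/andP; rewrite -/L in c1P; lra.
move=> /dP /=; rewrite gamG// ltr_norml => /andP[? ?]; lra.
Qed.

Lemma lin_opp (R : realType) (r s : R -> R) z :
  lin (fun x => - r x) (fun x => - s x) z = - lin r s z.
Proof. by rewrite /lin mulNr opprD. Qed.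

Lemma lvl_opp (R : realType) (r s : R -> R) c x :
  lvl (fun x => - r x) (fun x => - s x) c x = lvl r s (- c) x.
Proof. by rewrite /lvl invrN mulrN -mulNr; congr (_ / _); ring. Qed.

Lemma same_leaf_opp (R : realType) (r s : R -> R) z z' :
  same_leaf (fun x => - r x) (fun x => - s x) z z' -> same_leaf r s z z'.
Proof.
rewrite /same_leaf !lin_opp => -[/oppr_inj lE [st|[/eqP z1 e]]]; split=> //.
  by left=> t /st; rewrite oppr_eq0.
by right; split=> //; apply/eqP; move: z1; rewrite oppr_eq0.
Qed.

Lemma increasing_or_decreasing (R : realType) (f : R -> R) :
  continuous f -> injective f ->
  (f 0 < f 1 /\ {homo f : x y / x < y}) \/
  (f 1 < f 0 /\ {homo (fun x => - f x) : x y / x < y}).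
Proof.
move=> cf /(continuous_injective_monotone cf)[m|m]; [left|right]; split=> //; try exact: m.
by move=> x y /m; rewrite ltrN2.
Qed.

(** Changing the signs of [r], [s], [r'] and [s'] keeps the leaves and reverses the levels on both
    sides, which turns the upper statement into the lower one. *)
Lemma holonomy_unbounded_both (R : realType) (r s r' s' : R -> R) (h h' : R * R -> R * R)
    (x : R) :
  continuous r -> continuous s -> continuous r' -> continuous s' ->
  finite_set [set t | s' t = 0] -> continuous h -> continuous h' -> cancel h h' ->
  (forall w w', same_leaf r' s' w w' -> lin r s (h' w) = lin r s (h' w')) ->
  s x != 0 -> {homo holonomy r s r' s' h x : c c' / c < c'} ->
  (forall M, exists c, M < holonomy r s r' s' h x c) /\
  (forall M, exists c, holonomy r s r' s' h x c < M).
Proof.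
move=> cr cs cr' cs' fin ch ch' hK leaf sx m; split.
  exact: (holonomy_unbounded cr cs cr' cs' fin ch ch' hK leaf sx m).
move=> M.
have cN (f : R -> R) : continuous f -> continuous (fun x => - f x).
  by move=> cf t; apply: cvgN; exact: cf.
have [||||c] := @holonomy_unbounded R (fun x => - r x) (fun x => - s x) (fun x => - r' x)
  (fun x => - s' x) h h' x (cN _ cr) (cN _ cs) (cN _ cr') (cN _ cs') _ ch ch' hK _ _ _ (- M).
- have -> : [set t | - s' t = 0] = [set t | s' t = 0] => //.
  apply/seteqP; split=> t /=; last by move=> ->; rewrite oppr0.
  by move/eqP; rewrite oppr_eq0 => /eqP.
- by move=> w w' /same_leaf_opp/leaf; rewrite !lin_opp => ->.
- by rewrite oppr_eq0.
- by move=> c c' cc; rewrite /holonomy !lin_opp !lvl_opp ltrN2; apply: m; rewrite ltrN2.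
by rewrite /holonomy lin_opp lvl_opp ltrN2 => hc; exists (- c).
Qed.

(** * From a homeomorphism preserving leaves to a topological equivalence *)

Section LeafMap.
Variables (R : realType) (r s r' s' : R -> R) (h h' : R * R -> R * R).
Hypotheses (rs : tame r s) (rs' : tame r' s').
Hypotheses (ch : continuous h) (ch' : continuous h') (hK : cancel h h') (h'K : cancel h' h).
Hypothesis hleaf : forall z z', same_leaf r s z z' -> lin r' s' (h z) = lin r' s' (h z').
Hypothesis hleaf' : forall w w', same_leaf r' s' w w' -> lin r s (h' w) = lin r s (h' w').
Hypothesis hsingular : forall a, s a = 0 ->
  exists v, forall z, lin r s z = r a -> lin r' s' (h z) = v.

Let cr : continuous r. Proof. by case: rs. Qed.
Let cs : continuous s. Proof. by case: rs. Qed.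
Let cr' : continuous r'. Proof. by case: rs'. Qed.
Let cs' : continuous s'. Proof. by case: rs'. Qed.
Let hol := holonomy r s r' s' h.

Let clvl x : s x != 0 -> continuous (fun c => (x, lvl r s c x)).
Proof. by move=> sx c; apply: cvg_pairR; [exact: cvg_cst|apply: cvg_lvl => //; exact: cvg_cst]. Qed.

Lemma holonomy_continuous x : s x != 0 -> continuous (hol x).
Proof.
move=> sx c; have hc : (fun c => h (x, lvl r s c x)) @ c --> h (x, lvl r s c x).
  have lc : (fun c => (x, lvl r s c x)) @ c --> (x, lvl r s c x) by exact: clvl.
  by apply: (cvg_comp _ _ lc); exact: ch.
by apply: (cvg_comp _ _ hc); exact: lin_continuous.
Qed.

Lemma holonomy_strip x x' : strip s x x' -> hol x = hol x'.
Proof.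
move=> st; apply/funext => c; apply: hleaf; split; last by left.
by rewrite !lin_lvl ?(stripl st) ?(stripr st).
Qed.

(** Near [h z0] equal level means same leaf by [same_leaf_near], and [h'] sends a leaf into one
    level. *)
Lemma image_level_near (z0 : R * R) : exists2 N : set (R * R), nbhs z0 N &
  forall z z', N z -> N z' -> lin r' s' (h z) = lin r' s' (h z') -> lin r s z = lin r s z'.
Proof.
have [d d0 dP] := same_leaf_near rs' (h z0).
have n1 : \forall z \near z0, `|(h z).1 - (h z0).1| < d /\ `|(h z).2 - (h z0).2| < d.
  have hc : h @ z0 --> h z0 by exact: ch.
  have h1 : (fun z => (h z).1) @ z0 --> (h z0).1 by apply: (cvg_comp _ _ hc); exact: cvg_fst.
  have h2 : (fun z => (h z).2) @ z0 --> (h z0).2 by apply: (cvg_comp _ _ hc); exact: cvg_snd.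
  move/cvgrPdist_lt/(_ d d0): h1 => h1; move/cvgrPdist_lt/(_ d d0): h2 => h2.
  by apply: filterS (filterI h1 h2) => z [/= ? ?]; split; rewrite distrC.
exists [set z | `|(h z).1 - (h z0).1| < d /\ `|(h z).2 - (h z0).2| < d] => //.
move=> z z' [a1 a2] [b1 b2] e.
by rewrite -(hK z) -(hK z'); apply: hleaf'; exact: dP.
Qed.

Lemma holonomy_injective x : s x != 0 -> injective (hol x).
Proof.
move=> sx; apply: locally_injective_injective; first exact: holonomy_continuous.
move=> c; have [N nN NP] := image_level_near (x, lvl r s c x).
have lc : (fun c => (x, lvl r s c x)) @ c --> (x, lvl r s c x) by exact: clvl.
have := lc _ nN; move=> /nbhs_ballP[d /= d0 dP].
exists d => // c1 c2 c1d c2d e.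
have b1 : ball c d c1 by rewrite /ball /= distrC.
have b2 : ball c d c2 by rewrite /ball /= distrC.
by have := NP _ _ (dP _ b1) (dP _ b2) e; rewrite !lin_lvl.
Qed.

(** The direction of [hol x] is encoded by the boolean [hol x 0 < hol x 1]; this reads it off any
    other pair of levels. *)
Let incr_iff x : s x != 0 -> forall c c', c != c' -> hol x 0 < hol x 1 = ((c < c') == (hol x c < hol x c')).
Proof.
move=> sx c c' cc.
have [[d m]|[d m]] := increasing_or_decreasing (holonomy_continuous sx) (holonomy_injective sx).
  rewrite d; move: cc; rewrite neq_lt => /orP[l|l]; first by rewrite l (m _ _ l).
  by rewrite !ltNge (ltW l) (ltW (m _ _ l)).
rewrite ltNge (ltW d); move: cc; rewrite neq_lt => /orP[l|l].
  by have := m _ _ l; rewrite ltrN2 => g; rewrite l [hol x c < _]ltNge (ltW g).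
by have := m _ _ l; rewrite ltrN2 => ->; rewrite ltNge (ltW l).
Qed.

(** Along the segment [y = 0] both the level [r x] and its image value [m x] are injective near [a],
    so that each passes to the other side of its value at [a] when [x] crosses [a]. Comparing the
    two passages gives the same direction for the strips on both sides. *)
Let dir_near a : s a = 0 -> exists2 d : R, 0 < d & forall x y,
  `|x - a| < d -> `|y - a| < d -> s x != 0 -> s y != 0 ->
  (hol x 0 < hol x 1) = (hol y 0 < hol y 1).
Proof.
move=> sa; have [v vP] := hsingular sa.
have [k [k1 kk kP]] := tame_at rs sa; have [d0 d00 d0P] := kP 1 ltr01.
have [N nN NP] := image_level_near (a, 0).
pose m x := lin r' s' (h (x, 0)).
have cm : continuous m.
  move=> t; have lc : (fun t => (t, 0 : R)) @ t --> (t, 0 : R).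
    by apply: cvg_pairR; [exact: cvg_id|exact: cvg_cst].
  have hc : (fun t => h (t, 0)) @ t --> h (t, 0) by apply: (cvg_comp _ _ lc); exact: ch.
  by apply: (cvg_comp _ _ hc); exact: lin_continuous.
have lin0 x : lin r s (x, 0) = r x by rewrite /lin mulr0 addr0.
have /nbhs_ballP[d1 /= d10 d1P] : \forall t \near a, N (t, 0).
  have lc : (fun t => (t, 0 : R)) @ a --> (a, 0 : R).
    by apply: cvg_pairR; [exact: cvg_id|exact: cvg_cst].
  exact: lc.
pose d := Num.min d0 d1; have dd : 0 < d by rewrite lt_min d00.
have rinj x y : `|x - a| < d -> `|y - a| < d -> r x = r y -> x = y.
  rewrite !lt_min => /andP[xd _] /andP[yd _] rxy.
  have [l1 _ _] := d0P _ _ xd yd; have [l2 _ _] := d0P _ _ yd xd.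
  have [/l1|/l2|//] := ltgtP x y; by rewrite rxy subrr mulr0 ltxx.
have minj x y : `|x - a| < d -> `|y - a| < d -> m x = m y -> x = y.
  move=> xd yd mxy; apply: rinj => //; rewrite -!lin0; apply: NP => //.
    by apply: d1P; rewrite /ball /= distrC; move: xd; rewrite lt_min => /andP[].
  by apply: d1P; rewrite /ball /= distrC; move: yd; rewrite lt_min => /andP[].
have ad : `|a - a| < d by rewrite subrr normr0.
have ma : m a = v by apply: vP; rewrite lin0.
(* If [m] were above [v] on both sides, the smaller of the two values would be taken again across
   [a]; [nd'] is the case below. *)
have nd x y : `|x - a| < d -> `|y - a| < d -> x < a -> a < y ->
    v < m x -> v < m y -> False.
  move=> xd yd xa ay vx vy; have [xy|yx] := leP (m x) (m y).
    have [|t tt mt] := @IVT_setT R m a y (m x) cm; first by rewrite ma (ltW vx).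
    have tx : t = x by apply: minj (dist_between ad yd tt) xd mt.
    by move: tt; rewrite tx (min_idPl (ltW ay)) leNgt xa.
  have [|t tt mt] := @IVT_setT R m a x (m y) cm; first by rewrite ma !ltW.
  have ty : t = y by apply: minj (dist_between ad xd tt) yd mt.
  by move: tt; rewrite ty (max_idPl (ltW xa)) [y <= a]leNgt ay andbF.
have nd' x y : `|x - a| < d -> `|y - a| < d -> x < a -> a < y ->
    m x < v -> m y < v -> False.
  move=> xd yd xa ay vx vy; have [xy|yx] := leP (m x) (m y).
    have [|t tt mt] := @IVT_setT R m x a (m y) cm; first by rewrite ma (ltW vy) xy.
    have ty : t = y by apply: minj (dist_between xd ad tt) yd mt.
    by move: tt; rewrite ty (max_idPr (ltW xa)) [y <= a]leNgt ay andbF.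
  have [|t tt mt] := @IVT_setT R m y a (m x) cm; first by rewrite ma (ltW vx) ltW.
  have tx : t = x by apply: minj (dist_between yd ad tt) xd mt.
  by move: tt; rewrite tx (min_idPr (ltW ay)) leNgt xa.
(* The direction is read on the levels [r a] and [r z]. The first has the value [v] over each strip
   by [hsingular], the second passes through [(z, 0)]. *)
have dirE z : `|z - a| < d -> s z != 0 ->
    (hol z 0 < hol z 1) = ((r z < r a) == (m z < v)).
  move=> zd sz; have za : z != a by apply: contra sz => /eqP ->; rewrite sa.
  have -> : v = hol z (r a) by rewrite /hol /holonomy vP// lin_lvl.
  have -> : m z = hol z (r z) by rewrite /hol /holonomy /m /lvl subrr mul0r.
  by apply: incr_iff => //; apply: contra za => /eqP/rinj ->.
have opp x y : `|x - a| < d -> `|y - a| < d -> s x != 0 -> s y != 0 -> x < a -> a < y ->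
  (hol x 0 < hol x 1) = (hol y 0 < hol y 1).
  move=> xd yd sx sy xa ay; rewrite !dirE//.
  have -> : (r x < r a) = ~~ (r y < r a).
    have kx : 0 < k * (r a - r x).
      by have [||l _ _] := d0P x a => //; [move: xd; rewrite lt_min => /andP[]|rewrite subrr normr0|exact: l].
    have ky : 0 < k * (r y - r a).
      by have [||l _ _] := d0P a y => //; [rewrite subrr normr0|move: yd; rewrite lt_min => /andP[]|exact: l].
    have [k0|k0|k0] := ltgtP k 0; last by move: kx; rewrite k0 mul0r ltxx.
      move: kx ky; rewrite !nmulr_rgt0// !subr_lt0 => h1 h2.
      by rewrite h2 ltNge (ltW h1).
    move: kx ky; rewrite !pmulr_rgt0// !subr_gt0 => h1 h2.
    by rewrite h1 -leNgt (ltW h2).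
  have -> : (m x < v) = ~~ (m y < v).
    have [x1|x1|x1] := ltgtP (m x) v; have [y1|y1|y1] := ltgtP (m y) v => //.
    - by case: (nd' x y).
    - by case: (nd x y).
    - have ya : y = a by apply: minj => //; rewrite y1 ma.
      by move: ay; rewrite ya ltxx.
    - have xa' : x = a by apply: minj => //; rewrite x1 ma.
      by move: xa; rewrite xa' ltxx.
    - have xa' : x = a by apply: minj => //; rewrite x1 ma.
      by move: xa; rewrite xa' ltxx.
  by case: (r y < r a); case: (m y < v).
have [d2 d20 d2P] := tame_strip_side rs a.
exists (Num.min d d2); first by rewrite lt_min dd.
move=> x y; rewrite lt_min => /andP[xd xd2]; rewrite lt_min => /andP[yd yd2] sx sy.
have same : (x < a) = (y < a) -> (hol x 0 < hol x 1) = (hol y 0 < hol y 1).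
  move=> e; suff /holonomy_strip -> : strip s x y by [].
  have xa : x != a by apply: contra sx => /eqP ->; rewrite sa.
  have ya : y != a by apply: contra sy => /eqP ->; rewrite sa.
  exact: d2P.
have [xa|xa|xa] := ltgtP x a; last by move: sx; rewrite xa sa eqxx.
  have [ya|ya|ya] := ltgtP y a; last by move: sy; rewrite ya sa eqxx.
    by apply: same; rewrite xa ya.
  exact: opp.
have [ya|ya|ya] := ltgtP y a; last by move: sy; rewrite ya sa eqxx.
  by symmetry; exact: opp.
by apply: same; rewrite !ltNge !ltW.
Qed.

Let nonzero_near x0 (e : R) : 0 < e -> exists2 t, `|t - x0| < e & s t != 0.
Proof.
move=> e0; have [d d0 dP] := tame_isolated rs x0.
have m0 : 0 < Num.min e d by rewrite lt_min e0.
exists (x0 + Num.min e d / 2).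
  have me : Num.min e d <= e by rewrite ge_min lexx.
  by rewrite [x0 + _]addrC addrK gtr0_norm ?divr_gt0//; lra.
have md : Num.min e d <= d by rewrite ge_min lexx orbT.
apply: dP; first by rewrite [x0 + _]addrC addrK gtr0_norm ?divr_gt0//; lra.
by rewrite gt_eqF// ltrDl divr_gt0.
Qed.

Let dir_local x0 : exists2 d : R, 0 < d & forall x y,
  `|x - x0| < d -> `|y - x0| < d -> s x != 0 -> s y != 0 ->
  (hol x 0 < hol x 1) = (hol y 0 < hol y 1).
Proof.
have [s0|s0] := eqVneq (s x0) 0; first exact: dir_near.
have [d d0 dP] := tame_strip_near rs s0; exists d => // x y xd yd _ _.
by suff /holonomy_strip -> : strip s x y; last exact: dP.
Qed.

Let dir_const x y : s x != 0 -> s y != 0 ->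
  (hol x 0 < hol x 1) = (hol y 0 < hol y 1).
Proof.
(* Defined at the zeros of [s] as well, so that it can propagate along the whole line. *)
pose P x := exists2 d : R, 0 < d & forall t, `|t - x| < d -> s t != 0 -> hol t 0 < hol t 1.
have PP u v : P u -> P v.
  apply: locally_constant_constant => x0; have [d d0 dP] := dir_local x0.
  exists d => // u1 v1 ud vd [e e0 eP].
  have m0 : 0 < Num.min e (d - `|u1 - x0|) by rewrite lt_min e0 subr_gt0.
  have [t] := nonzero_near u1 m0; rewrite lt_min => /andP[te td] st.
  have it := eP t te st.
  exists (d - `|v1 - x0|); first by rewrite subr_gt0.
  have near w w0 : `|w - w0| < d - `|w0 - x0| -> `|w - x0| < d.
    by move=> h1; have := ler_normD (w - w0) (w0 - x0); rewrite addrA subrK; lra.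
  by move=> w wd sw; rewrite (dP w t)//; [exact: near wd|exact: near td].
have PE u : s u != 0 -> hol u 0 < hol u 1 <-> P u.
  move=> su; split=> [iu|[d d0 dP]]; last by apply: dP => //; rewrite subrr normr0.
  have [d d0 dP] := dir_local u; exists d => // t td st.
  by rewrite (dP t u)// subrr normr0.
by move=> sx sy; apply/idP/idP => /PE; [move=> /(_ sx)/(PP _ y)/(PE y sy)|move=> /(_ sy)/(PP _ x)/(PE x sx)].
Qed.

Let hol_unbounded x : s x != 0 ->
  (forall M, exists c, M < hol x c) /\ (forall M, exists c, hol x c < M).
Proof.
move=> sx; have [_ _ fin _] := rs'.
have [[_ m]|[_ m]] := increasing_or_decreasing (holonomy_continuous sx) (holonomy_injective sx).
  exact: (holonomy_unbounded_both cr cs cr' cs' fin ch ch' hK hleaf' sx m).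
have cN (f : R -> R) : continuous f -> continuous (fun x => - f x).
  by move=> cf t; apply: cvgN; exact: cf.
have [|||up dn] := @holonomy_unbounded_both R r s (fun x => - r' x)
  (fun x => - s' x) h h' x cr cs (cN _ cr') (cN _ cs') _ ch ch' hK _ sx.
- have -> : [set t | - s' t = 0] = [set t | s' t = 0] => //.
  apply/seteqP; split=> t /=; last by move=> ->; rewrite oppr0.
  by move/eqP; rewrite oppr_eq0 => /eqP.
- by move=> w w' /same_leaf_opp/hleaf'.
- by move=> c c' /m; rewrite /holonomy !lin_opp.
split=> M.
  by have [c] := dn (- M); rewrite /holonomy lin_opp ltrN2; exists c.
by have [c] := up (- M); rewrite /holonomy lin_opp ltrN2; exists c.
Qed.

Let hol_inverse x : exists gi : R -> R, s x != 0 ->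
  [/\ cancel (hol x) gi, cancel gi (hol x) & continuous gi].
Proof.
have [sx|sx] := eqVneq (s x) 0; first by exists id.
have [up dn] := hol_unbounded sx; have ch1 := holonomy_continuous sx.
have surj y : exists c, hol x c = y.
  have [a fa] := dn y; have [b fb] := up y.
  have [|c _ <-] := @IVT_setT R (hol x) a b y ch1; first by rewrite !ltW.
  by exists c.
have [gi giK] := choice surj; exists gi => _.
have Kgi : cancel (hol x) gi by move=> c; apply: (holonomy_injective sx); rewrite giK.
by split=> //; exact: inverse_continuous Kgi giK.
Qed.

Lemma leaf_map_equivalent : topologically_equivalent (lin r s) (lin r' s').
Proof.
have [x0 _ sx0] := nonzero_near 0 ltr01.
have [gi giP] := choice hol_inverse.
have [lK Kl cl] := giP x0 sx0; set l := hol x0 in lK Kl.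
pose U x c := gi x (l c); pose V x c := gi x0 (hol x c).
have gi_strip x x' : strip s x x' -> gi x = gi x'.
  move=> st; have [? K1 _] := giP x (stripl st); have [K2 _ _] := giP x' (stripr st).
  by apply/funext => c; rewrite -[in RHS](K1 c) (holonomy_strip st) K2.
have hol_lt x c c' : s x != 0 -> c != c' -> (hol x c < hol x c') = ((c < c') == (l 0 < l 1)).
  move=> sx cc; rewrite /l (dir_const sx0 sx) (incr_iff sx cc).
  by case: (c < c'); case: (hol x c < hol x c').
have hol_inj x := @holonomy_injective x.
(* Since [hol x] and [hol y] have the same direction, a map that carries one to the other is
   increasing. This serves for both [U] and [V]. *)
have mono x y (u : R -> R) : s x != 0 -> s y != 0 -> (forall c, hol y (u c) = hol x c) ->
    {homo u : c c' / c < c'}.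
  move=> sx sy uE c c' cc; have ne : c != c' by rewrite lt_eqF.
  have une : u c != u c'.
    by apply: contra ne => /eqP e; apply/eqP/(hol_inj x sx); rewrite -!uE e.
  have := hol_lt x c c' sx ne; rewrite -!uE (hol_lt y _ _ sy une) cc.
  by case: (u c < u c'); case: (l 0 < l 1).
have fixl x a : s x != 0 -> s a = 0 -> hol x (r a) = l (r a).
  move=> sx sa; have [v vP] := hsingular sa.
  by rewrite /l /hol /holonomy !vP// lin_lvl.
have ccomp (u v : R -> R) : continuous u -> continuous v -> continuous (u \o v).
  by move=> cu cv t; apply: continuous_comp; [exact: cv|exact: cu].
have Uch : level_change r s U.
  split.
  - by move=> x x' st; rewrite /U (gi_strip _ _ st).
  - move=> x sx; have [_ _ cg] := giP x sx.
    by apply: (ccomp (gi x) l) => //; exact: holonomy_continuous.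
  - move=> x sx; apply: (mono x0 x) => // c; have [_ K _] := giP x sx.
    by rewrite /U K.
  - by move=> x a sx sa; have [K _ _] := giP x sx; rewrite /U -(fixl x)// K.
have Vch : level_change r s V.
  split.
  - by move=> x x' st; rewrite /V (holonomy_strip st).
  - move=> x sx; apply: (ccomp (gi x0) (hol x)) => //; exact: holonomy_continuous.
  - by move=> x sx; apply: (mono x x0) => // c; exact: Kl.
  - by move=> x a sx sa; rewrite /V fixl// lK.
have [||K [[K' [KK K'K cK cK']] Kzero Kst Klin]] := level_change_homeomorphism rs Uch Vch.
- by move=> x sx c; have [_ K _] := giP x sx; rewrite /U /V K lK.
- by move=> x sx c; have [K _ _] := giP x sx; rewrite /U /V Kl K.
exists (h \o K), l; split.
- exists (K' \o h'); split.
  + by move=> z /=; rewrite hK KK.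
  + by move=> z /=; rewrite K'K h'K.
  + by move=> z; apply: continuous_comp; [exact: cK|exact: ch].
  + by move=> z; apply: continuous_comp; [exact: ch'|exact: cK'].
- by exists (gi x0); split=> //; exact: holonomy_continuous.
apply/funext => z /=; have [sz|sz] := eqVneq (s z.1) 0.
  rewrite Kzero// lin_zero//; have [v vP] := hsingular sz.
  by rewrite vP ?lin_zero// /l /hol /holonomy vP// lin_lvl.
have zs := Kst z sz; have [_ K1 _] := giP z.1 sz.
have -> : lin r' s' (h (K z)) = hol (K z).1 (lin r s (K z)).
  by rewrite /hol /holonomy lvl_lin ?(stripr zs)//; case: (K z).
by rewrite -(holonomy_strip zs) Klin// /U K1.
Qed.

End LeafMap.

(** * Bifurcation values *)

Section SubtypeMaps.

Lemma cvg_compose (X Y Z : topologicalType) (f : X -> Y) (g : Y -> Z) (x : X) :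
  f @ x --> f x -> g @ f x --> g (f x) -> (fun t => g (f t)) @ x --> g (f x).
Proof. by move=> cf cg; exact: (continuous_comp cf cg). Qed.

Lemma cvg_subtype (T X : topologicalType) (A : set X) (f : T -> A) (t0 : T) :
  (fun t => val (f t)) @ t0 --> val (f t0) -> f @ t0 --> f t0.
Proof.
move=> fx N [_ /= [[W oW <-] /= Wx WN]].
have WF : \forall t \near t0, W (val (f t)) by apply: fx; exact: open_nbhs_nbhs.
suff : \forall t \near t0, N (f t) by [].
by apply: filterS WF => t Wt; exact: (WN (f t) Wt).
Qed.

Lemma val_subtype_continuous (X : topologicalType) (A : set X) :
  continuous (val : A -> X).
Proof. by move=> x; have := @initial_continuous A X set_val x; rewrite set_valE. Qed.

Definition subtype_map (X Y : topologicalType) (f : X -> Y) (A : set X) (B : set Y)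
    (AB : forall x, A x -> B (f x)) (x : A) : B :=
  SigSub (mem_set (AB _ (set_mem (valP x)))).

Lemma subtype_map_continuous (X Y : topologicalType) (f : X -> Y) (A : set X) (B : set Y)
    (AB : forall x, A x -> B (f x)) : continuous f -> continuous (subtype_map AB).
Proof.
move=> cf x; have h : (fun t : A => f (val t)) @ x --> f (val x).
  have v : (val : A -> X) @ x --> val x by exact: val_subtype_continuous.
  exact: (cvg_compose v (cf _)).
by apply: cvg_subtype; exact: h.
Qed.

End SubtypeMaps.

Lemma locally_trivial_transfer (X Y X' Y' : topologicalType) (p : X -> Y) (q : X' -> Y')
    (h : X -> X') (h' : X' -> X) (l : Y -> Y') (l' : Y' -> Y) (y : Y) :
  continuous q -> continuous h -> continuous h' -> continuous l -> continuous l' ->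
  cancel h h' -> cancel h' h -> cancel l l' -> cancel l' l -> l \o p = q \o h ->
  locally_trivial_at p y -> locally_trivial_at q (l y).
Proof.
move=> cq ch ch' cl cl' hK h'K lK l'K lp [U [nU [cp [F [phi [[phi' [K1 K2 c1 c2]] pphi]]]]]].
have lpE x : l (p x) = q (h x) by have := congr1 (fun f => f x) lp.
pose U' := l' @^-1` U.
exists U'; split; first by apply: cl'; rewrite lK.
split.
  move=> x; have hq : (fun t : q @^-1` U' => q (val t)) @ x --> q (val x).
    have v : (val : q @^-1` U' -> X') @ x --> val x by exact: val_subtype_continuous.
    exact: (cvg_compose v (cq _)).
  by apply: cvg_subtype; exact: hq.
have UU' u : U u -> U' (l u) by rewrite /U' /= lK.
have U'U u : U' u -> U (l' u) by [].
have AB z : (p @^-1` U) z -> (q @^-1` U') (h z) by rewrite /U' /= -lpE lK.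
have BA z : (q @^-1` U') z -> (p @^-1` U) (h' z).
  by rewrite /U' /= => qz; rewrite -(lK (p _)) lpE h'K.
pose phi2 (w : F * U') := subtype_map AB (phi (w.1, subtype_map U'U w.2)).
pose psi2 (z : q @^-1` U') : F * U' :=
  let w := phi' (subtype_map BA z) in (w.1, subtype_map UU' w.2).
exists F, phi2; split; last first.
  apply/funext => -[m u] /=; apply: val_inj => /=.
  have := congr1 (fun f => val (f (m, subtype_map U'U u))) pphi => /= e.
  by rewrite -lpE e l'K.
exists psi2; split.
- move=> [m u]; rewrite /psi2 /phi2 /=.
  have -> : subtype_map BA (subtype_map AB (phi (m, subtype_map U'U u))) =
      phi (m, subtype_map U'U u) by apply: val_inj; rewrite /= hK.
  by rewrite K1 /=; congr (_, _); apply: val_inj; rewrite /= l'K.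
- move=> z; rewrite /psi2 /phi2 /=; apply: val_inj => /=.
  set w := phi' _.
  have -> : (w.1, subtype_map U'U (subtype_map UU' w.2)) = w.
    by case: w => m u /=; congr (_, _); apply: val_inj; rewrite /= lK.
  by rewrite /w K2 /= h'K.
- move=> w.
  have h2 : (fun w : F * U' => subtype_map U'U w.2) @ w --> subtype_map U'U w.2.
    have s2 : (@snd F U') @ w --> w.2 by exact: cvg_snd.
    apply: (cvg_compose s2); exact: subtype_map_continuous.
  have hp : (fun w : F * U' => (w.1, subtype_map U'U w.2)) @ w --> (w.1, subtype_map U'U w.2).
    have s1 : (@fst F U') @ w --> w.1 by exact: cvg_fst.
    exact: (@cvg_pair _ _ _ (nbhs w) (nbhs w.1) (nbhs (subtype_map U'U w.2))).
  have hphi : (fun w : F * U' => phi (w.1, subtype_map U'U w.2)) @ w -->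
      phi (w.1, subtype_map U'U w.2).
    by apply: (cvg_compose hp); exact: c1.
  by apply: (cvg_compose hphi); exact: subtype_map_continuous.
- move=> z; pose w z := phi' (subtype_map BA z).
  have hb : subtype_map BA @ z --> subtype_map BA z by exact: subtype_map_continuous.
  have cw : w @ z --> w z by apply: (cvg_compose hb); exact: c2.
  have w1 : (fun z => (w z).1) @ z --> (w z).1 by apply: (cvg_compose cw); exact: cvg_fst.
  have w2 : (fun z => (w z).2) @ z --> (w z).2 by apply: (cvg_compose cw); exact: cvg_snd.
  have w3 : (fun z => subtype_map UU' (w z).2) @ z --> subtype_map UU' (w z).2.
    by apply: (cvg_compose w2); exact: subtype_map_continuous.
  exact: (@cvg_pair _ _ _ (nbhs z) (nbhs (w z).1) (nbhs (subtype_map UU' (w z).2))).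
Qed.

Lemma bifurcation_set_transfer (X Y X' Y' : topologicalType) (p : X -> Y) (q : X' -> Y')
    (h : X -> X') (h' : X' -> X) (l : Y -> Y') (l' : Y' -> Y) (y : Y) :
  continuous p -> continuous q ->
  continuous h -> continuous h' -> continuous l -> continuous l' ->
  cancel h h' -> cancel h' h -> cancel l l' -> cancel l' l -> l \o p = q \o h ->
  bifurcation_set p y <-> bifurcation_set q (l y).
Proof.
move=> cp cq ch ch' cl cl' hK h'K lK l'K lp.
have lp' : l' \o q = p \o h'.
  by apply/funext => z /=; rewrite -[in LHS](h'K z) -[q _](congr1 (fun f => f (h' z)) lp) /= lK.
split=> b t; apply: b.
  by rewrite -(lK y); exact: (locally_trivial_transfer cp ch' ch cl' cl h'K hK l'K lK lp').
exact: (locally_trivial_transfer cq ch ch' cl cl' hK h'K lK l'K lp).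
Qed.

(* If the fibration were trivial over a neighbourhood of [r a], the sections
   through a point of the vertical leaf and through a point of the level [r a] to
   its right would meet a nearby level in one and the same strip, and a path
   joining them there would be carried to a path inside the level [r a]
   leaving the vertical leaf. *)
Lemma zero_bifurcation (R : realType) (r s : R -> R) (a : R) :
  tame r s -> s a = 0 -> bifurcation_set (lin r s) (r a).
Proof.
move=> rs sa [U [nU [_ [F [phi [[phi' [K1 K2 c1 c2]] pphi]]]]]].
case: (rs) => cr cs _ _; set p := lin r s in phi phi' K1 K2 c1 c2 pphi *.
have Ua : U (r a) by exact: nbhs_singleton.
pose va : U := SigSub (mem_set Ua).
have pa : (p @^-1` U) (a, 0) by rewrite /= /p lin_zero.
pose za : p @^-1` U := SigSub (mem_set pa).
(* Total maps into the subtypes; the defaults are taken only off [U] and off its preimage, hence not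
   at levels close to [r a]. *)
pose mkU (u : R) : U := insubd va u.
pose mkX (z : R * R) : p @^-1` U := insubd za z.
have mkUK u : U u -> val (mkU u) = u by move=> Uu; rewrite /mkU insubdK//; exact: mem_set.
have mkXK z : U (p z) -> val (mkX z) = z by move=> Uz; rewrite /mkX insubdK//; exact: mem_set.
have phi'2 (X : p @^-1` U) : val (phi' X).2 = p (val X).
  have := congr1 (fun f => val (f (phi' X))) pphi => /= <-.
  by rewrite K2.
have pphiE m u : p (val (phi (m, u))) = val u.
  by have := congr1 (fun f => val (f (m, u))) pphi.
pose sec m u := val (phi (m, mkU u)).
have csec m : sec m @ r a --> sec m (r a).
  have cU : mkU @ r a --> mkU (r a).
    apply: cvg_subtype; rewrite mkUK//.
    have : id @ r a --> r a by exact: cvg_id.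
    by apply: cvg_trans; apply: near_eq_cvg; apply: filterS nU => u Uu; rewrite mkUK.
  have cm : (fun u => (m, mkU u)) @ r a --> (m, mkU (r a)).
    apply: (@cvg_pair _ _ _ (nbhs (r a)) (nbhs m) (nbhs (mkU (r a)))) => //.
    exact: cvg_cst.
  have cphi : (fun u => phi (m, mkU u)) @ r a --> phi (m, mkU (r a)).
    by apply: (cvg_compose cm); exact: c1.
  by apply: (cvg_compose cphi); exact: val_subtype_continuous.
have thr z : p z = r a -> exists m, sec m (r a) = z.
  move=> pz; have Uz : U (p z) by rewrite pz.
  exists (phi' (mkX z)).1; rewrite /sec.
  have -> : mkU (r a) = (phi' (mkX z)).2.
    by apply: val_inj; rewrite mkUK// phi'2 mkXK.
  by rewrite -surjective_pairing K2 mkXK.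
have [k [k1 kk side]] := tame_side rs sa; have [d d0 dP] := tame_isolated rs a.
have [m0 m0E] := thr (a, 0) (lin_zero (z := (a, 0)) _ sa).
pose x1 := a + d / 2.
have sx1 : s x1 != 0.
  apply: dP; first by rewrite /x1 [a + _]addrC addrK gtr0_norm ?divr_gt0//; lra.
  by rewrite gt_eqF// /x1 ltrDl divr_gt0.
have [m1 m1E] := thr (x1, lvl r s (r a) x1) (lin_lvl _ _ sx1).
have [d1 d10 d1P] := side 1.
have secm m (e : R) : 0 < e -> \forall u \near r a,
    `|(sec m u).1 - (sec m (r a)).1| < e /\ `|(sec m u).2 - (sec m (r a)).2| < e.
  move=> e0.
  have h1 : (fun u => (sec m u).1) @ r a --> (sec m (r a)).1.
    by apply: (cvg_comp _ _ (csec m)); exact: cvg_fst.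
  have h2 : (fun u => (sec m u).2) @ r a --> (sec m (r a)).2.
    by apply: (cvg_comp _ _ (csec m)); exact: cvg_snd.
  move/cvgrPdist_lt/(_ e e0): h1 => h1; move/cvgrPdist_lt/(_ e e0): h2 => h2.
  by apply: filterS (filterI h1 h2) => z [/= ? ?]; split; rewrite distrC.
(* The bounds 1 and [d1] allow [side] to be applied to the section through [(a, 0)]. The bound
   [d / 4] keeps the other one, which starts at [a + d / 2], to the right of [a] and within [d] of
   it. *)
pose e0 := Num.min 1 (Num.min d1 (d / 4)).
have e0_gt0 : 0 < e0 by rewrite !lt_min ltr01 d10 divr_gt0.
have /nbhs_ballP[e /= e_gt0 eP] : \forall u \near r a, U u /\
    ((`|(sec m0 u).1 - (sec m0 (r a)).1| < e0 /\ `|(sec m0 u).2 - (sec m0 (r a)).2| < e0) /\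
     (`|(sec m1 u).1 - (sec m1 (r a)).1| < e0 /\ `|(sec m1 u).2 - (sec m1 (r a)).2| < e0)).
  by apply: filterI => //; apply: filterI; exact: secm.
(* The level is taken on the side that forces the section through the vertical leaf to move to the
   right of [a]. *)
pose u := r a + k * (e / 2).
have /eP[Uu [[h01 h02] [h11 h12]]] : ball (r a) e u.
  rewrite /ball /= /u opprD addrA subrr add0r normrN normrM k1 mul1r gtr0_norm ?divr_gt0//.
  by lra.
have ku : 0 < k * (u - r a).
  by rewrite /u [r a + _]addrC addrK mulrA kk mul1r divr_gt0.
have psec m : p (sec m u) = u by rewrite /sec pphiE mkUK.
have [xi0 xi0d] : a < (sec m0 u).1 /\ `|(sec m0 u).1 - a| < d.
  move: h01 h02; rewrite m0E /= subr0 !lt_min => /and3P[_ h01 h01'] /and3P[h02 _ _].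
  split; last by apply: lt_trans h01' _; move: d0; clear; lra.
  have [] := d1P (sec m0 u).1 (sec m0 u).2 h01 (ltW h02).
  rewrite -surjective_pairing -/p psec => _ lo _.
  have [//|lt|eq] := ltgtP a (sec m0 u).1.
    by have := lt_trans ku (lo lt); rewrite ltxx.
  by move: ku; rewrite -(psec m0) /p lin_zero -eq// subrr mulr0 ltxx.
have [xi1 xi1d] : a < (sec m1 u).1 /\ `|(sec m1 u).1 - a| < d.
  move: h11; rewrite m1E /= /x1 !lt_min => /and3P[_ _]; move: d0; clear.
  by rewrite !ltr_norml => d0 /andP[? ?]; split; [lra|apply/andP; lra].
pose lo := Num.min (sec m0 u).1 (sec m1 u).1; pose hi := Num.max (sec m0 u).1 (sec m1 u).1.
have lohi : lo <= hi by rewrite /lo /hi ge_min le_max lexx.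
have snz t : lo <= t <= hi -> s t != 0.
  move=> tt; apply: dP; first exact: dist_between tt.
  by case/andP: tt => lot _; rewrite gt_eqF// (lt_le_trans _ lot)// lt_min xi0.
pose cl := clamp lo hi.
have scl t : s (cl t) != 0 by apply: snz; exact: clamp_itv.
pose pt t := (cl t, lvl r s u (cl t)).
have cpt : continuous pt.
  move=> t; have clt : cl @ t --> cl t by exact: clamp_continuous.
  by apply: cvg_pairR => //; apply: cvg_lvl => //; exact: cvg_cst.
have ppt t : p (pt t) = u by rewrite /p lin_lvl.
(* The path [pt] inside the level [u] is carried to the level [r a] with its fibre coordinate
   unchanged. The clamp in [pt] makes it a path over the whole line. *)
pose psi t := val (phi ((phi' (mkX (pt t))).1, va)).
have cpsi : continuous psi.
  move=> t; have cX : (fun t => mkX (pt t)) @ t --> mkX (pt t).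
    apply: cvg_subtype; rewrite mkXK ?ppt//.
    have -> : (fun t => val (mkX (pt t))) = pt by apply/funext => z; rewrite mkXK ?ppt.
    exact: cpt.
  have cX' : (fun t => phi' (mkX (pt t))) @ t --> phi' (mkX (pt t)).
    by apply: (cvg_compose cX); exact: c2.
  have cX1 : (fun t => (phi' (mkX (pt t))).1) @ t --> (phi' (mkX (pt t))).1.
    by apply: (cvg_compose cX'); exact: cvg_fst.
  have cp : (fun t => ((phi' (mkX (pt t))).1, va)) @ t --> ((phi' (mkX (pt t))).1, va).
    apply: (@cvg_pair _ _ _ (nbhs t) (nbhs (phi' (mkX (pt t))).1) (nbhs va)) => //.
    exact: cvg_cst.
  have cphi : (fun t => phi ((phi' (mkX (pt t))).1, va)) @ t --> phi ((phi' (mkX (pt t))).1, va).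
    by apply: (cvg_compose cp); exact: c1.
  by apply: (cvg_compose cphi); exact: val_subtype_continuous.
have ppsi t : p (psi t) = r a by rewrite /psi pphiE.
have psiE m : lo <= (sec m u).1 <= hi -> psi (sec m u).1 = sec m (r a).
  move=> h; rewrite /psi.
  have -> : mkX (pt (sec m u).1) = phi (m, mkU u).
    apply: val_inj; rewrite mkXK ?ppt// /pt /cl clamp_id//.
    by rewrite -(lvlE (snz _ h) (psec m)) -surjective_pairing.
  rewrite K1 /= /sec; congr (val (phi (_, _))).
  by apply: val_inj; rewrite mkUK.
have E0 : (psi (sec m0 u).1).1 = a.
  by rewrite psiE ?m0E//; rewrite /lo /hi ge_min le_max lexx.
have E1 : (psi (sec m1 u).1).1 = x1.
  by rewrite psiE ?m1E//; rewrite /lo /hi ge_min le_max lexx !orbT.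
suff : (psi (sec m1 u).1).1 = a by rewrite E1 => /eqP; rewrite gt_eqF// ltrDl divr_gt0.
(* The condition is open because, on bounded parts, [side] leaves no point of the level [r a] near
   the line over [a] except on this line. *)
move: E0; apply: (@locally_constant_constant R (fun t => (psi t).1 = a)) => t.
have p1 : (fun t => (psi t).1) @ t --> (psi t).1 by apply: (cvg_comp _ _ (cpsi t)); exact: cvg_fst.
have p2 : (fun t => (psi t).2) @ t --> (psi t).2 by apply: (cvg_comp _ _ (cpsi t)); exact: cvg_snd.
have [pta|pta] := eqVneq (psi t).1 a; last first.
  have n0 : 0 < `|(psi t).1 - a| by rewrite normr_gt0 subr_eq0.
  move/cvgrPdist_lt/(_ _ n0)/nbhs_ballP: p1 => [d2 /= d20 d2P].
  exists d2 => // x y xd _ xa.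
  have : ball t d2 x by rewrite /ball /= distrC.
  by move=> /d2P /=; rewrite xa ltxx.
have [d3 d30 d3P] := side (`|(psi t).2| + 1).
move/cvgrPdist_lt/(_ _ d30): p1 => p1; move/cvgrPdist_lt/(_ _ ltr01): p2 => p2.
have /nbhs_ballP[d2 /= d20 d2P] : \forall y \near t,
    `|(psi t).1 - (psi y).1| < d3 /\ `|(psi t).2 - (psi y).2| < 1 by exact: filterI.
exists d2 => // x y _ yd _.
have : ball t d2 y by rewrite /ball /= distrC.
move=> /d2P[/=]; rewrite pta distrC => q1 q2.
have q3 : `|(psi y).2| <= `|(psi t).2| + 1.
  rewrite -[X in `|X|](subrK (psi t).2) addrC; apply: (le_trans (ler_normD _ _)).
  by rewrite lerD2l distrC ltW.
have [] := d3P (psi y).1 (psi y).2 q1 q3; rewrite -surjective_pairing -/p ppsi subrr mulr0.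
move=> g l _; have [/l|/g|//] := ltgtP (psi y).1 a; by rewrite ltxx.
Qed.

(** * Foliations and the theorem *)

Lemma foliation_same_leaf (R : realType) (r s : R -> R) (q : R * R -> R) (h : R * R -> R * R)
    (z z' : R * R) :
  continuous r -> continuous s ->
  (forall L, foliation (lin r s) L -> foliation q (h @` L)) ->
  same_leaf r s z z' -> q (h z) = q (h z').
Proof.
move=> cr cs hF zz'.
have [|w wE] := hF (connected_component (lin r s @^-1` [set lin r s z]) z); first by exists z.
have qw u : connected_component (lin r s @^-1` [set lin r s z]) z u -> q (h u) = q w.
  move=> cu; have : (h @` connected_component (lin r s @^-1` [set lin r s z]) z) (h u) by exists u.
  by rewrite wE => /connected_component_sub.
rewrite !qw//; first exact: same_leaf_component.
exact: connected_component_refl.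
Qed.

(** The image of a leaf is a component that contains [h z], hence the whole leaf through [h z].
    Therefore the inverse sends leaves to leaves as well. *)
Lemma foliation_same_leaf_inv (R : realType) (r s : R -> R) (p : R * R -> R)
    (h h' : R * R -> R * R) (w w' : R * R) :
  continuous r -> continuous s -> cancel h h' -> cancel h' h ->
  (forall L, foliation p L -> foliation (lin r s) (h @` L)) ->
  same_leaf r s w w' -> p (h' w) = p (h' w').
Proof.
move=> cr cs hK h'K hF ww'; set q := lin r s in hF.
pose Cp z := connected_component (p @^-1` [set p z]) z.
pose Cq z := connected_component (q @^-1` [set q z]) z.
have CpE z : h @` Cp z = Cq (h z).
  have [|v vE] := hF (Cp z); first by exists z.
  have : (h @` Cp z) (h z) by exists z => //; exact: connected_component_refl.
  rewrite vE => vz; have qe : q (h z) = q v by exact: connected_component_sub vz.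
  by rewrite /Cq qe; exact: same_connected_component.
have Cww : Cq w = Cq w'.
  have c := same_leaf_component cr cs ww'; rewrite /Cq -[q w'](proj1 ww').
  exact: same_connected_component.
have : (h @` Cp (h' w)) w'.
  rewrite CpE h'K Cww -(h'K w') -CpE.
  by exists (h' w') => //; exact: connected_component_refl.
by move=> [z Cz <-]; rewrite hK; have := connected_component_sub Cz.
Qed.

Lemma homeomorphism_component (X Y : topologicalType) (h : X -> Y) (h' : Y -> X)
    (A : set X) (B : set Y) (x : X) :
  continuous h -> continuous h' -> cancel h h' -> cancel h' h ->
  (forall x, A x <-> B (h x)) ->
  h @` connected_component A x = connected_component B (h x).
Proof.
move=> ch ch' hK h'K AB.
have [Ax|Ax] := pselect (A x); last first.
  rewrite !connected_component_out ?image_set0//; by rewrite -AB.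
apply/seteqP; split.
  apply: connected_component_max.
  - by exists x => //; exact: connected_component_refl.
  - by move=> _ [z /connected_component_sub/AB ? <-].
  - by apply: connected_continuous_connected; [exact: component_connected|exact: continuous_subspaceT].
move=> y By; exists (h' y) => //; move: (h' y) (imageP h' By).
apply: connected_component_max.
- by exists (h x); [apply: connected_component_refl; exact/AB|rewrite hK].
- by move=> _ [z /connected_component_sub Bz <-]; apply/AB; rewrite h'K.
- by apply: connected_continuous_connected; [exact: component_connected|exact: continuous_subspaceT].
Qed.

(** Without vertical leaves each level is a graph over the whole line, and changing the ordinate at
    fixed abscissa and level suffices. *)
Lemma nonsingular_equivalent (R : realType) (r s r' s' : R -> R) :
  continuous r -> continuous s -> continuous r' -> continuous s' ->
  (forall x, s x != 0) -> (forall x, s' x != 0) ->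
  topologically_equivalent (lin r s) (lin r' s').
Proof.
move=> cr cs cr' cs' s0 s0'.
pose T (r s r' s' : R -> R) (z : R * R) := (z.1, lvl r' s' (lin r s z) z.1).
have cT (r1 s1 r2 s2 : R -> R) : continuous r1 -> continuous s1 -> continuous r2 ->
    continuous s2 -> (forall x, s2 x != 0) -> continuous (T r1 s1 r2 s2).
  move=> c1 c2 c3 c4 n z; apply: cvg_pairR; first exact: cvg_fst.
  by apply: cvg_lvl => //; [exact: lin_continuous|exact: cvg_fst].
have TK (r1 s1 r2 s2 : R -> R) : (forall x, s1 x != 0) -> (forall x, s2 x != 0) ->
    cancel (T r1 s1 r2 s2) (T r2 s2 r1 s1).
  by move=> n1 n2 z; rewrite /T /= lin_lvl// lvl_lin//; case: z.
exists (T r s r' s'), id; split.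
- by exists (T r' s' r s); split; [exact: TK|exact: TK|exact: cT|exact: cT].
- by exists id; split=> // x; exact: cvg_id.
- by apply/funext => z /=; rewrite /T lin_lvl.
Qed.

Lemma equivalent_foliations (R : realType) (p q : R * R -> R) (h : R * R -> R * R)
    (l : R -> R) :
  continuous p -> continuous q -> homeomorphism h -> homeomorphism l -> l \o p = q \o h ->
  equivalence_homeomorphism (foliation p) (foliation q) h /\
  [/\ set_bij (bifurcation_set p) (bifurcation_set q) l,
      monotone_on (bifurcation_set p) l &
      forall c, bifurcation_set q c ->
        p @^-1` (bifurcation_set p `&` l @^-1` [set c]) = h @^-1` (q @^-1` [set c])].
Proof.
move=> cp cq hh [l' [lK l'K cl cl']] lp.
have lpE z : l (p z) = q (h z) by have := congr1 (fun f => f z) lp.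
have [h' [hK h'K ch ch']] := hh.
have bif y : bifurcation_set p y <-> bifurcation_set q (l y).
  exact: (bifurcation_set_transfer y cp cq ch ch' cl cl' hK h'K lK l'K lp).
split.
  split=> // _ [z ->]; exists (h z).
  apply: (homeomorphism_component _ ch ch' hK h'K) => x /=; rewrite -!lpE.
  by split=> [->//|/(can_inj lK)].
split.
- split.
  + by move=> y /bif.
  + by move=> x y _ _ /(can_inj lK).
  + by move=> y By; exists (l' y); [apply/bif; rewrite l'K|rewrite l'K].
- have [m|m] := continuous_injective_monotone cl (can_inj lK).
    by left=> x y _ _ /m.
  by right=> x y _ _ /m.
- move=> c Bc; apply/seteqP; split=> z /=; rewrite -lpE; first by case.
  by move=> e; split=> //; apply/bif; rewrite e.
Qed.

Theorem corollary1p2 (R : realType) (p q : R * R -> R)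
    (hp : finite_linear_like_submersion p)
    (hq : finite_linear_like_submersion q) :
  topologically_equivalent p q <->
  (bifurcation_set p = set0 /\ bifurcation_set q = set0) \/
  (foliations_equivalent (foliation p) (foliation q) /\
   exists (h : R * R -> R * R) (sigma : R -> R),
     [/\ equivalence_homeomorphism (foliation p) (foliation q) h,
         set_bij (bifurcation_set p) (bifurcation_set q) sigma,
         monotone_on (bifurcation_set p) sigma &
         forall c : R, bifurcation_set q c ->
           p @^-1` (bifurcation_set p `&` sigma @^-1` [set c]) =
           h @^-1` (q @^-1` [set c])]).
Proof.
have [r [s [pE rs]]] := finite_linear_like_tame hp.
have [r' [s' [qE rs']]] := finite_linear_like_tame hq.
have [cr cs _ _] := rs; have [cr' cs' _ _] := rs'.
split.
  move=> [h [l [hh hl lp]]]; right.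
  have cp : continuous p by rewrite pE; exact: lin_continuous.
  have cq : continuous q by rewrite qE; exact: lin_continuous.
  have [hF [sb sm sc]] := equivalent_foliations cp cq hh hl lp.
  by split; [exists h|exists h, l; split].
move=> [[Bp Bq]|[_ [h [sigma [[[h' [hK h'K ch ch']] hF] [sigma_fun _ _] _ sigma_fib]]]]].
  rewrite pE qE; apply: nonsingular_equivalent => // x; apply/eqP => sx.
    by have : bifurcation_set p (r x) by [rewrite pE; exact: zero_bifurcation]; rewrite Bp.
  by have : bifurcation_set q (r' x) by [rewrite qE; exact: zero_bifurcation]; rewrite Bq.
rewrite pE qE in hF sigma_fun sigma_fib *.
apply: (leaf_map_equivalent rs rs' ch ch' hK h'K).
- by move=> z z'; exact: foliation_same_leaf.
- by move=> w w'; exact: foliation_same_leaf_inv.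
- move=> a sa; have Ba := zero_bifurcation rs sa.
  (* The fibre condition at [c = sigma (r a)]: as [r a] is a bifurcation value, its whole level lies
     in the left-hand set. *)
  exists (sigma (r a)) => z pz.
  have : (h @^-1` (lin r' s' @^-1` [set sigma (r a)])) z; last by [].
  by rewrite -sigma_fib ?/preimage/= ?pz//; exact: sigma_fun.
Qed.
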